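(* The exact-value problem for functional discounted-sum automata over finite words is decidable in PSPACE; in particular, it is decidable in PSPACE for unambiguous and for deterministic discounted-sum automata.
   Context: A discounted-sum automaton (DSA) is a tuple $\mathcal A=\langle\Sigma,Q,q_{in},Q_F,\delta,\gamma,\lambda\rangle$ with a finite alphabet $\Sigma$, a finite set of states $Q$, an initial state $q_{in}\in Q$, accepting states $Q_F\subseteq Q$, a transition relation $\delta\subseteq Q\times\Sigma\times Q$, a weight function $\gamma:\delta\to\mathbb Q$, and a rational discount factor $0<\lambda<1$. A run on a finite word $\sigma_1\cdots\sigma_n$ is a sequence $q_0,\sigma_1,q_1,\dots,\sigma_n,q_n$ with $q_0=q_{in}$ and $(q_i,\sigma_{i+1},q_{i+1})\in\delta$ for all $i$; it is accepting if $q_n\in Q_F$. Its value is $\sum_{i=0}^{n-1}\lambda^i\gamma(q_i,\sigma_{i+1},q_{i+1})$. The value $\mathcal A(w)$ of a finite word $w$ is the infimum of the values of the accepting runs of $\mathcal A$ on $w$. $\mathcal A$ is functional if for every finite word $w$ all accepting runs of $\mathcal A$ on $w$ have the same value. The exact-value problem asks, given a DSA $\mathcal A$ and $t\in\mathbb Q$, whether there exists a finite word $w$ with $\mathcal A(w)=t$. *)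

(* Defs.v *)
From mathcomp Require Import all_boot all_order all_algebra.
Set Implicit Arguments. Unset Strict Implicit. Unset Printing Implicit Defensive.
Import Order.TTheory GRing.Theory Num.Theory.
Local Open Scope ring_scope.

(* States are 0..nQ-1, letters are 0..nSig-1.  A transition entry      *)
(* (q, a, q', g) means (q,a,q') \in delta with weight gamma = g.       *)
Record DSA := MkDSA {
  nQ : nat;
  nSig : nat;
  qin : nat;
  QF : seq nat;
  trans : seq (nat * nat * nat * rat);
  disc : rat }.

Definition tr_src (e : nat * nat * nat * rat) : nat := e.1.1.1.
Definition tr_let (e : nat * nat * nat * rat) : nat := e.1.1.2.
Definition tr_dst (e : nat * nat * nat * rat) : nat := e.1.2.
Definition tr_wt  (e : nat * nat * nat * rat) : rat := e.2.

(* well-formedness: indices in range, gamma is a function on delta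
   (no triple listed twice), 0 < lambda < 1 *)
Definition wf_DSA (A : DSA) : Prop :=
  [/\ (qin A < nQ A)%N,
      all (fun q => q < nQ A)%N (QF A),
      all (fun e => [&& tr_src e < nQ A, tr_let e < nSig A & tr_dst e < nQ A]%N)
          (trans A),
      uniq [seq (tr_src e, tr_let e, tr_dst e) | e <- trans A]
    & 0 < disc A < 1].

Definition in_delta (A : DSA) (q a q' : nat) : bool :=
  has (fun e => [&& tr_src e == q, tr_let e == a & tr_dst e == q']) (trans A).

(* gamma(q,a,q') (meaningful when (q,a,q') \in delta) *)
Definition gamma (A : DSA) (q a q' : nat) : rat :=
  match [seq e <- trans A | [&& tr_src e == q, tr_let e == a & tr_dst e == q']] with
  | e :: _ => tr_wt e
  | [::] => 0
  end.

Definition word_over (A : DSA) (w : seq nat) : bool := all (fun a => a < nSig A)%N w.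

Definition is_run (A : DSA) (w r : seq nat) : Prop :=
  [/\ size r = (size w).+1,
      nth 0%N r 0 = qin A
    & forall i, (i < size w)%N -> in_delta A (nth 0%N r i) (nth 0%N w i) (nth 0%N r i.+1)].

Definition is_acc_run (A : DSA) (w r : seq nat) : Prop :=
  is_run A w r /\ nth 0%N r (size w) \in QF A.

Definition run_value (A : DSA) (w r : seq nat) : rat :=
  \sum_(i < size w) disc A ^+ i * gamma A (nth 0%N r i) (nth 0%N w i) (nth 0%N r i.+1).

(* A(w) = t : t is the infimum of the values of the accepting runs on w.
   Since there are finitely many runs, the infimum equals t iff t is the
   value of some accepting run and is below all of them (the infimum of the
   empty set is +oo, which is never a rational t). *)
Definition value_is (A : DSA) (w : seq nat) (t : rat) : Prop :=
  (exists r, is_acc_run A w r /\ run_value A w r = t) /\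
  (forall r, is_acc_run A w r -> t <= run_value A w r).

Definition exact_value (A : DSA) (t : rat) : Prop :=
  exists w, word_over A w /\ value_is A w t.

Definition functional (A : DSA) : Prop :=
  forall w, word_over A w -> forall r1 r2,
    is_acc_run A w r1 -> is_acc_run A w r2 -> run_value A w r1 = run_value A w r2.

Definition unambiguous (A : DSA) : Prop :=
  forall w, word_over A w -> forall r1 r2,
    is_acc_run A w r1 -> is_acc_run A w r2 -> r1 = r2.

Definition deterministic (A : DSA) : Prop :=
  forall q a q1 q2, in_delta A q a q1 -> in_delta A q a q2 -> q1 = q2.

Fixpoint bin_aux (fuel n : nat) : seq bool :=
  match fuel with
  | 0 => [::]
  | f.+1 => if n == 0%N then [::] else odd n :: bin_aux f n./2
  end.
Definition bits (n : nat) : seq bool := bin_aux n n.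

(* self-delimiting: each binary digit b as (true, b), terminated by (false,false) *)
Definition enc_nat (n : nat) : seq bool :=
  flatten [seq [:: true; b] | b <- bits n] ++ [:: false; false].
Definition enc_int (z : int) : seq bool :=
  match z with Posz n => false :: enc_nat n | Negz n => true :: enc_nat n end.
Definition enc_rat (x : rat) : seq bool := enc_int (numq x) ++ enc_int (denq x).
Definition enc_list T (f : T -> seq bool) (s : seq T) : seq bool :=
  enc_nat (size s) ++ flatten (map f s).
Definition enc_trans (e : nat * nat * nat * rat) : seq bool :=
  enc_nat (tr_src e) ++ enc_nat (tr_let e) ++ enc_nat (tr_dst e) ++ enc_rat (tr_wt e).
Definition enc_instance (A : DSA) (t : rat) : seq bool :=
  enc_nat (nQ A) ++ enc_nat (nSig A) ++ enc_nat (qin A) ++ enc_list enc_nat (QF A)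
  ++ enc_list enc_trans (trans A) ++ enc_rat (disc A) ++ enc_rat t.

Unset Implicit Arguments.
Inductive dir := DL | DR | DS.

Record TM := MkTM {
  tm_st : finType;
  tm_gam : finType;
  tm_blank : tm_gam;
  tm_in : bool -> tm_gam;
  tm_start : tm_st;
  tm_delta : tm_st -> tm_gam -> option (tm_st * tm_gam * dir);
  tm_acc : tm_st -> bool }.

(* configuration: state, written tape contents (cells 0..), head position *)
Definition config (M : TM) : Type := (tm_st M * seq (tm_gam M) * nat)%type.

Definition tm_step (M : TM) (c : config M) : option (config M) :=
  let: (q, tp, h) := c in
  match tm_delta M q (nth (tm_blank M) tp h) with
  | None => None
  | Some (q', g', d) =>
      Some (q', set_nth (tm_blank M) tp h g',
            match d with DL => h.-1 | DR => h.+1 | DS => h end)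
  end.

Definition tm_init (M : TM) (x : seq bool) : config M :=
  (tm_start M, map (tm_in M) x, 0%N).

Fixpoint tm_run (M : TM) (k : nat) (c : config M) : option (config M) :=
  match k with
  | 0 => Some c
  | k'.+1 => obind (tm_step M) (tm_run M k' c)
  end.

Definition cfg_space (M : TM) (c : config M) : nat := maxn (size c.1.2) c.2.+1.

Definition tm_halts (M : TM) (x : seq bool) : Prop :=
  exists k c, tm_run M k (tm_init M x) = Some c /\ tm_step M c = None.

Definition tm_accepts (M : TM) (x : seq bool) : Prop :=
  exists k c, [/\ tm_run M k (tm_init M x) = Some c, tm_step M c = None & tm_acc M c.1.1].

Definition tm_space_bounded (M : TM) (x : seq bool) (s : nat) : Prop :=
  forall k c, tm_run M k (tm_init M x) = Some c -> (cfg_space M c <= s)%N.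

Definition exact_value_in_PSPACE (P : DSA -> Prop) : Prop :=
  exists (M : TM) (c d : nat),
    forall (A : DSA) (t : rat), wf_DSA A -> P A ->
      let x := enc_instance A t in
      [/\ tm_halts M x,
          tm_space_bounded M x (c * size x ^ d + c)%N
        & (tm_accepts M x <-> exact_value A t)].

(* Main.v *)
Require Import Defs.
From mathcomp Require Import all_boot all_order all_algebra.
From mathcomp Require Import zify ring lra.
From Stdlib Require Import FunctionalExtensionality.
Set Implicit Arguments. Unset Strict Implicit. Unset Printing Implicit Defensive.
Import Order.TTheory GRing.Theory Num.Theory.

(** For a functional automaton A(w) = t just says that some accepting run on w has
    value t.  Follow the remaining target t_0 = t, t_(i+1) = (t_i - weight) / lambda along
    such a run.  If D is a common denominator of t and of the weights and lambda = p / q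
    in lowest terms, then p^i D t_i is an integer because the target is met from the left,
    and some q^j D t_i is one because t_i is the value of the remaining suffix; p and q
    being coprime, D t_i is an integer.  It is at most D max|weight| q in absolute value,
    hence bounded by the cube of the number N whose binary digits are the input.  The
    problem is thus reachability in an implicit graph with polynomially many nodes in N,
    which Savitch's recursion decides in polynomial space.

    The Turing machine is obtained in two steps.  A machine with finitely many binary
    tracks simulates a counter program as long as the counters stay below 2^poly, since
    running time is irrelevant.  The functions computed by such programs are closed under
    composition, under recursion and while loops with bounded intermediate values, and
    therefore contain the arithmetic, the decoding of the input and the stack machine
    that carries out Savitch's recursion. *)

(** * Machine fragments on a multi-track tape *)

(** The remaining targets are the values of the suffixes of a run, and a priori their denominators
    grow with the length of the run; integrality of D t_i is what leaves finitely many of them. Each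
    factor of the cube is at most N for its own reason. D is a product of denominators, and their
    binary lengths add up inside the input. The largest weight is written in the input. The factor q
    comes from 1 / (1 - p/q) = q / (q - p), which is at most q. Functionality removes the universal
    quantifier hidden in the infimum, and with it the word, so the graph forgets letters. The
    decider never computes D: it tries every positive D below a bound. This is sound because a path
    ending in target 0 describes a genuine run for any D, and complete because the common
    denominator is among those tried. Space is controlled through values alone. Everything,
    including Savitch's stack, is a natural number held in a register, so one bound on the registers
    bounds the tape. *)

Section Fragments.
Variable T : finType.

(** The set lists the tracks whose digit in this cell is 1, and [None] is the blank. The boolean
    marks the left end, which a [TM] cannot detect: moving left from cell 0 leaves the head
    there. *)
Definition sym : finType := option (bool * {set T}).

(** The next state [None] is an exit to which further code can be attached; a fragment never gets
    stuck. *)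
Record frag := Frag {
  fr_st : finType;
  fr_start : fr_st;
  fr_delta : fr_st -> sym -> option fr_st * sym * dir }.

Definition move_head (d : dir) (h : nat) : nat :=
  match d with DL => h.-1 | DR => h.+1 | DS => h end.

Definition tape_space (tp : seq sym) (h : nat) : nat := maxn (size tp) h.+1.

Definition fr_step (F : frag) (s : fr_st F) (tp : seq sym) (h : nat) :
    option (fr_st F) * seq sym * nat :=
  let: (o, g, d) := fr_delta s (nth None tp h) in
  (o, set_nth None tp h g, move_head d h).

(** Space is checked only where a step starts. The last configuration is checked by whatever
    continues from it, which makes runs concatenate freely. *)
Inductive fr_runs (F : frag) (W : nat) :
    option (fr_st F) * seq sym * nat -> option (fr_st F) * seq sym * nat -> Prop :=
| FrRefl c : fr_runs W c c
| FrStep s tp h c : tape_space tp h <= W ->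
    fr_runs W (fr_step s tp h) c -> fr_runs W (Some s, tp, h) c.

Lemma fr_runs_trans (F : frag) W (a b c : option (fr_st F) * seq sym * nat) :
  fr_runs W a b -> fr_runs W b c -> fr_runs W a c.
Proof. by elim=> [//|s tp h d sp _ IH] /IH; apply: FrStep. Qed.

(** One simulation serves all compound fragments: [e] is where the exit of [F] leads, be it the next
    fragment, a loop head or the exit of the whole. *)
Lemma fr_runs_map (F G : frag) (phi : fr_st F -> fr_st G) (e : option (fr_st G)) W :
  (forall s g, fr_delta (phi s) g =
     let: (o, g', d) := fr_delta s g in (if o is Some s' then Some (phi s') else e, g', d)) ->
  forall c c', fr_runs W c c' ->
  let ext (o : option (fr_st F)) := if o is Some s then Some (phi s) else e in
  fr_runs W (ext c.1.1, c.1.2, c.2) (ext c'.1.1, c'.1.2, c'.2).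
Proof.
move=> simG c c'; elim=> {c c'} [c|s tp h c sp _ IH] /=; first exact: FrRefl.
apply: FrStep => //; move: IH; rewrite /fr_step /= simG.
by case: (fr_delta _ _) => [[o g] d].
Qed.

(* The left end of the tape carries a mark, and track [r] holds a number with its
   least significant digit first.  A zero test may leave one blank written
   just after the used cells; [j] records whether it did. *)
Definition tape (L : seq {set T}) (j : bool) : seq sym :=
  (if L is A :: L' then Some (true, A) :: [seq Some (false, B) | B <- L'] else [::])
  ++ nseq j None.

Lemma size_tape L j : size (tape L j) = size L + j.
Proof. by rewrite size_cat size_nseq; case: L => //= A L; rewrite size_map. Qed.

Lemma nth_tape pre A rest j :
  nth None (tape (pre ++ A :: rest) j) (size pre) = Some (nilp pre, A).
Proof.
case: pre => [//|B pre] /=.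
by rewrite nth_cat size_map size_cat addnS ltnS leq_addr map_cat nth_cat size_map ltnn subnn.
Qed.

Lemma set_nth_cat (S : Type) (x0 : S) (s1 s2 : seq S) i y :
  set_nth x0 (s1 ++ s2) (size s1 + i) y = s1 ++ set_nth x0 s2 i y.
Proof. by elim: s1 => [|x s1 IH] //=; rewrite IH. Qed.

Lemma set_tape pre A A' rest j :
  set_nth None (tape (pre ++ A :: rest) j) (size pre) (Some (nilp pre, A')) =
  tape (pre ++ A' :: rest) j.
Proof.
case: pre => [//|B pre]; rewrite /tape /= !map_cat -!catA.
have <- : size [seq Some (false, C) | C <- pre] + 0 = size pre by rewrite addn0 size_map.
by rewrite set_nth_cat.
Qed.

Lemma nth_tape_end L j : nth None (tape L j) (size L) = None.
Proof.
have h : nth None (tape L j) (size (tape L false)) = None.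
  by rewrite /tape cats0 nth_cat ltnn subnn; case: j.
by move: h; rewrite size_tape addn0.
Qed.

Lemma set_tape_end L j : set_nth None (tape L j) (size L) None = tape L true.
Proof.
have <- : size (tape L false) = size L by rewrite size_tape addn0.
rewrite /tape cats0 -[X in set_nth _ _ X]addn0 set_nth_cat.
by case: j.
Qed.

Lemma set_tape_extend L j A : ~~ nilp L ->
  set_nth None (tape L j) (size L) (Some (false, A)) = tape (rcons L A) false.
Proof.
move=> L0; have <- : size (tape L false) = size L by rewrite size_tape addn0.
rewrite {1 2}/tape cats0 -[X in set_nth _ _ X]addn0 set_nth_cat.
case: L L0 => //= B L _; rewrite /tape /= map_rcons cats0 -cats1.
by case: j.
Qed.

Lemma tape_space_le L j h W : size L < W -> h < W -> tape_space (tape L j) h <= W.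
Proof.
by move=> a b; rewrite /tape_space size_tape geq_max b andbT; case: j => /=; lia.
Qed.

(** Every instruction ends with this walk back to the mark, so that fragments compose with the head
    always at cell 0. *)
Lemma fr_rewind (F : frag) (sB : fr_st F) (o : option (fr_st F)) W L j h :
  (forall A, fr_delta sB (Some (true, A)) = (o, Some (true, A), DS)) ->
  (forall A, fr_delta sB (Some (false, A)) = (Some sB, Some (false, A), DL)) ->
  size L < W -> h < size L ->
  fr_runs W (Some sB, tape L j, h) (o, tape L j, 0).
Proof.
move=> dT dF LW; elim: h => [|h IH] hL.
  apply: FrStep; first by apply: tape_space_le => //; lia.
  case: L LW hL => [//|A L] LW _; rewrite /fr_step /= dT; exact: FrRefl.
apply: FrStep; first by apply: tape_space_le => //; lia.
have -> : fr_step sB (tape L j) h.+1 = (Some sB, tape L j, h).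
  have eL : L = take h.+1 L ++ nth set0 L h.+1 :: drop h.+2 L.
    by rewrite -drop_nth // cat_take_drop.
  have st : size (take h.+1 L) = h.+1 by rewrite size_takel // ltnW.
  have np : nilp (take h.+1 L) = false by rewrite /nilp st.
  rewrite /fr_step eL -[X in nth _ _ X]st nth_tape np dF -[X in set_nth _ _ X]st -np set_tape.
  by rewrite -eL.
by apply: IH; apply: ltnW.
Qed.

Definition track_val (r : T) (L : seq {set T}) : nat :=
  foldr (fun (A : {set T}) acc => (r \in A) + acc.*2) 0 L.

Section IncDec.
Variable R : T.

Fixpoint incr_tracks (L : seq {set T}) :=
  if L is A :: L' then if R \in A then (A :\ R) :: incr_tracks L' else (R |: A) :: L'
  else [:: [set R]].

Fixpoint decr_tracks (L : seq {set T}) :=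
  if L is A :: L' then if R \in A then (A :\ R) :: L' else (R |: A) :: decr_tracks L'
  else [::].

Lemma track_val_incr L : track_val R (incr_tracks L) = (track_val R L).+1.
Proof.
elim: L => [|A L IH] /=; first by rewrite inE eqxx.
by case: ifP => RA /=; rewrite !inE eqxx ?RA /= ?IH ?RA; lia.
Qed.

Lemma track_val_decr L : 0 < track_val R L -> track_val R (decr_tracks L) = (track_val R L).-1.
Proof.
elim: L => [//|A L IH] /=.
case: ifP => RA /=; rewrite !inE eqxx /= ?RA ?add0n // => L0.
by rewrite IH; lia.
Qed.

Lemma track_val_incr_neq r' L : r' != R ->
  track_val r' (incr_tracks L) = track_val r' L.
Proof.
move=> /negbTE e.
by elim: L => [|A L IH] /=; [rewrite inE e | case: ifP => RA /=; rewrite !inE e ?IH].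
Qed.

Lemma track_val_decr_neq r' L : r' != R ->
  track_val r' (decr_tracks L) = track_val r' L.
Proof.
move=> /negbTE e.
by elim: L => [|A L IH] //=; case: ifP => RA /=; rewrite !inE e ?IH.
Qed.

Lemma size_decr L : size (decr_tracks L) = size L.
Proof. by elim: L => [|A L IH] //=; case: ifP => _ /=; rewrite ?IH. Qed.

Lemma size_incr L : size L <= size (incr_tracks L).
Proof. by elim: L => [|A L IH] //=; case: ifP => _ /=. Qed.

(** A new cell is needed only when the carry leaves the used cells, and a value below 2 ^ W has no
    digit beyond the first W. *)
Lemma size_incr_le L W : size L <= W -> (track_val R L).+1 < 2 ^ W -> size (incr_tracks L) <= W.
Proof.
elim: L W => [|A L IH] [|W] //=.
rewrite !ltnS => LW; case: ifP => RA //= lt.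
by rewrite ltnS; apply: IH => //; move: lt; rewrite expnS; lia.
Qed.

(** State [false] propagates the carry and state [true] rewinds. The cell appended on a blank is
    written without the mark, so the tape must already have its first cell. *)
Definition inc_frag : frag := @Frag bool false (fun s g =>
  match s, g with
  | false, Some (m, A) => if R \in A then (Some false, Some (m, A :\ R), DR)
                          else (Some true, Some (m, R |: A), DS)
  | false, None => (Some true, Some (false, [set R]), DS)
  | true, Some (true, _) => (None, g, DS)
  | true, _ => (Some true, g, DL)
  end).

Definition dec_frag : frag := @Frag bool false (fun s g =>
  match s, g with
  | false, Some (m, A) => if R \in A then (Some true, Some (m, A :\ R), DS)
                          else (Some false, Some (m, R |: A), DR)
  | false, None => (None, None, DS)
  | true, Some (true, _) => (None, g, DS)
  | true, _ => (Some true, g, DL)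
  end).

Lemma inc_frag_carry W pre rest j : size (pre ++ incr_tracks rest) < W ->
  ~~ nilp (pre ++ rest) ->
  exists j' h', h' < size (pre ++ incr_tracks rest) /\
  @fr_runs inc_frag W (Some false, tape (pre ++ rest) j, size pre)
    (Some true, tape (pre ++ incr_tracks rest) j', h').
Proof.
elim: rest pre => [|A rest IH] pre /=.
  rewrite cats0 => sW pre0; exists false, (size pre); split.
    by rewrite size_cat addn1.
  move: sW; rewrite size_cat addn1 => sW.
apply: FrStep; first by apply: tape_space_le; lia.
  rewrite /fr_step nth_tape_end /= set_tape_extend // cats1; exact: FrRefl.
move=> sW pre0.
have := size_incr rest; case: ifP sW => RA; rewrite size_cat /= => sW szi.
- have [||j' [h' [hs runs]]] := IH (rcons pre (A :\ R)).
  + by rewrite cat_rcons size_cat.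
  + by rewrite cat_rcons; case: (pre).
  exists j', h'; split; first by move: hs; rewrite cat_rcons size_cat.
  move: runs; rewrite !cat_rcons size_rcons => runs.
  apply: FrStep; first by apply: tape_space_le; rewrite ?size_cat /=; lia.
  by rewrite /fr_step nth_tape /= RA set_tape.
exists j, (size pre); split; first by lia.
apply: FrStep; first by apply: tape_space_le; rewrite ?size_cat /=; lia.
rewrite /fr_step nth_tape /= RA set_tape; exact: FrRefl.
Qed.

Lemma inc_frag_runs W L j : size (incr_tracks L) < W -> ~~ nilp L ->
  exists j', @fr_runs inc_frag W (Some false, tape L j, 0) (None, tape (incr_tracks L) j', 0).
Proof.
move=> sW L0; have [j' [h' [hs runs]]] := @inc_frag_carry W [::] L j sW L0.
exists j'; apply: fr_runs_trans runs _.
exact: fr_rewind.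
Qed.

Lemma dec_frag_borrow W pre rest j : size (pre ++ rest) < W -> 0 < track_val R rest ->
  exists h', h' < size (pre ++ rest) /\
  @fr_runs dec_frag W (Some false, tape (pre ++ rest) j, size pre)
    (Some true, tape (pre ++ decr_tracks rest) j, h').
Proof.
elim: rest pre => [//|A rest IH] pre sW /=.
have sp : tape_space (tape (pre ++ A :: rest) j) (size pre) <= W.
  by apply: tape_space_le => //; move: sW; rewrite size_cat /=; lia.
case: ifP => RA /= pos.
  exists (size pre); split; first by rewrite size_cat /=; lia.
  apply: FrStep => //; rewrite /fr_step nth_tape /= RA set_tape; exact: FrRefl.
have [||h' [hs runs]] := IH (rcons pre (R |: A)).
- by rewrite cat_rcons; move: sW; rewrite !size_cat.
- by lia.
exists h'; split; first by move: hs; rewrite cat_rcons !size_cat.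
move: runs; rewrite !cat_rcons size_rcons => runs.
by apply: FrStep => //; rewrite /fr_step nth_tape /= RA set_tape.
Qed.

Lemma dec_frag_runs W L j : size L < W -> 0 < track_val R L ->
  @fr_runs dec_frag W (Some false, tape L j, 0) (None, tape (decr_tracks L) j, 0).
Proof.
move=> sW L0; have [h' [hs runs]] := @dec_frag_borrow W [::] L j sW L0.
by apply: fr_runs_trans runs _; apply: fr_rewind => //; rewrite size_decr.
Qed.

(** State [inl None] searches the track for a digit 1, [inl (Some b)] rewinds while remembering the
    outcome, and [inr] runs the body. The search may step onto the cell after the used ones and
    write a blank there, which is what the flag [j] of [tape] records. *)
Definition while_frag (F : frag) : frag :=
  @Frag (option bool + fr_st F)%type (inl None) (fun s g =>
  match s with
  | inl None =>
      match g with
      | Some (m, A) => if R \in A then (Some (inl (Some true)), g, DS)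
                       else (Some (inl None), g, DR)
      | None => (Some (inl (Some false)), None, DL)
      end
  | inl (Some b) =>
      match g with
      | Some (true, _) => (if b then Some (inr (fr_start F)) else None, g, DS)
      | _ => (Some (inl (Some b)), g, DL)
      end
  | inr s =>
      let: (o, g', d) := fr_delta s g in
      (Some (if o is Some s' then inr s' else inl None), g', d)
  end).

Lemma while_frag_scan F W pre rest j : size (pre ++ rest) < W -> ~~ nilp (pre ++ rest) ->
  exists j' h', h' < size (pre ++ rest) /\
  @fr_runs (while_frag F) W (Some (inl None), tape (pre ++ rest) j, size pre)
    (Some (inl (Some (track_val R rest != 0))), tape (pre ++ rest) j', h').
Proof.
elim: rest pre => [|A rest IH] pre sW n0.
  rewrite cats0 /= in sW n0 *; exists true, (size pre).-1; split.
    by case: (pre) n0.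
  apply: FrStep; first by apply: tape_space_le; lia.
  rewrite /fr_step nth_tape_end /= set_tape_end; exact: FrRefl.
have sp : tape_space (tape (pre ++ A :: rest) j) (size pre) <= W.
  by apply: tape_space_le => //; move: sW; rewrite size_cat /=; lia.
case RA: (R \in A).
  exists j, (size pre); split; first by rewrite size_cat /=; lia.
  rewrite /= RA addn_eq0 /=.
  apply: FrStep => //; rewrite /fr_step nth_tape /= RA set_tape; exact: FrRefl.
have [||j' [h' [hs runs]]] := IH (rcons pre A).
- by rewrite cat_rcons.
- by rewrite cat_rcons.
exists j', h'; split; first by rewrite -cat_rcons.
move: runs; rewrite cat_rcons size_rcons /= RA add0n double_eq0 => runs.
by apply: FrStep => //; rewrite /fr_step nth_tape /= RA set_tape.
Qed.

Lemma while_frag_test F W L j : size L < W -> ~~ nilp L ->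
  exists j', @fr_runs (while_frag F) W (Some (inl None), tape L j, 0)
    (if track_val R L != 0 then Some (inr (fr_start F)) else None, tape L j', 0).
Proof.
move=> sW L0; have [j' [h' [hs runs]]] := @while_frag_scan F W [::] L j sW L0.
exists j'; apply: fr_runs_trans runs _.
by apply: fr_rewind.
Qed.

End IncDec.

Definition skip_frag : frag := @Frag unit tt (fun _ g => (None, g, DS)).

Definition seq_frag (F G : frag) : frag :=
  @Frag (fr_st F + fr_st G)%type (inl (fr_start F)) (fun s g =>
  match s with
  | inl s => let: (o, g', d) := fr_delta s g in
             (Some (if o is Some s' then inl s' else inr (fr_start G)), g', d)
  | inr s => let: (o, g', d) := fr_delta s g in
             (if o is Some s' then Some (inr s') else None, g', d)
  end).

Lemma seq_frag_runs F G W tp1 tp2 tp3 h1 h2 h3 :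
  @fr_runs F W (Some (fr_start F), tp1, h1) (None, tp2, h2) ->
  @fr_runs G W (Some (fr_start G), tp2, h2) (None, tp3, h3) ->
  @fr_runs (seq_frag F G) W (Some (fr_start (seq_frag F G)), tp1, h1) (None, tp3, h3).
Proof.
move=> r1 r2; apply: fr_runs_trans.
  apply: (@fr_runs_map F (seq_frag F G) inl (Some (inr (fr_start G))) W _ _ _ r1).
  by move=> s g /=; case: (fr_delta s g) => [[[?|] ?] ?].
apply: (@fr_runs_map G (seq_frag F G) inr None W _ _ _ r2).
by move=> s g /=; case: (fr_delta s g) => [[[?|] ?] ?].
Qed.

Variable t0 : T.

(** Besides marking the first cell, this appends a digit 1 to the input, the leading digit of
    [code_bits]. *)
Definition load_frag : frag := @Frag (option bool) None (fun s g =>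
  match s, g with
  | None, Some (_, A) => (Some (Some false), Some (true, A), DR)
  | None, None => (None, None, DS)
  | Some false, Some _ => (Some (Some false), g, DR)
  | Some false, None => (Some (Some true), Some (false, [set t0]), DL)
  | Some true, Some (true, _) => (None, g, DS)
  | Some true, _ => (Some (Some true), g, DL)
  end).

Definition input_sym (b : bool) : sym := Some (false, if b then [set t0] else set0).

Definition input_tracks (x : seq bool) : seq {set T} :=
  [seq if b then [set t0] else set0 | b : bool <- x].

Lemma load_frag_scan W pre rest : size (pre ++ rest) + 2 < W -> ~~ nilp pre ->
  @fr_runs load_frag W (Some (Some false), tape (pre ++ rest) false, size pre)
    (Some (Some true), tape (rcons (pre ++ rest) [set t0]) false, (size (pre ++ rest)).-1).
Proof.
elim: rest pre => [|A rest IH] pre sW n0.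
  rewrite cats0 in sW *; apply: FrStep; first by apply: tape_space_le; lia.
  rewrite /fr_step nth_tape_end /= set_tape_extend //; exact: FrRefl.
apply: FrStep; first by apply: tape_space_le => //; move: sW; rewrite size_cat /=; lia.
rewrite /fr_step nth_tape /= set_tape.
have := IH (rcons pre A); rewrite cat_rcons size_rcons; apply=> //.
by case: (pre).
Qed.

Lemma load_frag_runs W x : x != [::] -> size x + 2 < W ->
  @fr_runs load_frag W (Some None, map input_sym x, 0)
    (None, tape (rcons (input_tracks x) [set t0]) false, 0).
Proof.
case: x => [//|b x] _ sW.
apply: FrStep; first by rewrite /tape_space geq_max size_map /=; move: sW => /=; lia.
have -> : @fr_step load_frag None (map input_sym (b :: x)) 0 =
   (Some (Some false), tape ([:: if b then [set t0] else set0] ++ input_tracks x) false, 1).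
  by rewrite /fr_step /= /tape /= cats0 /input_tracks -map_comp.
apply: fr_runs_trans.
  apply: (@load_frag_scan W [:: _] (input_tracks x)) => //.
  by rewrite size_cat size_map; move: sW => /=; lia.
have sz : size (rcons (input_tracks (b :: x)) [set t0]) = (size x).+2.
  by rewrite size_rcons size_map.
by apply: fr_rewind => //; rewrite sz; move: sW; rewrite /= ?size_map; lia.
Qed.

End Fragments.

(** * Counter programs and their Turing machines *)

Inductive cmd :=
  | Skip
  | Inc of nat
  | Dec of nat
  | Seq of cmd & cmd
  | While of nat & cmd.

Definition upd (s : nat -> nat) (r v : nat) : nat -> nat :=
  fun i => if i == r then v else s i.

(** A derivation certifies termination, that no increment goes beyond [B], and that no decrement is
    applied to 0. *)
Inductive exec (B : nat) : cmd -> (nat -> nat) -> (nat -> nat) -> Prop :=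
  | ExSkip s : exec B Skip s s
  | ExInc r s : s r < B -> exec B (Inc r) s (upd s r (s r).+1)
  | ExDec r s : 0 < s r -> exec B (Dec r) s (upd s r (s r).-1)
  | ExSeq c1 c2 s1 s2 s3 : exec B c1 s1 s2 -> exec B c2 s2 s3 -> exec B (Seq c1 c2) s1 s3
  | ExWhile0 r c s : s r = 0 -> exec B (While r c) s s
  | ExWhileS r c s1 s2 s3 : 0 < s1 r -> exec B c s1 s2 -> exec B (While r c) s2 s3 ->
      exec B (While r c) s1 s3.

Fixpoint max_reg (c : cmd) : nat :=
  match c with
  | Skip => 0
  | Inc r | Dec r => r
  | Seq c1 c2 => maxn (max_reg c1) (max_reg c2)
  | While r c => maxn r (max_reg c)
  end.

Section Compile.
Variable k : nat.

Definition track (r : nat) : 'I_k.+1 := inord r.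

Fixpoint frag_of (c : cmd) : frag 'I_k.+1 :=
  match c with
  | Skip => skip_frag _
  | Inc r => inc_frag (track r)
  | Dec r => dec_frag (track r)
  | Seq c1 c2 => seq_frag (frag_of c1) (frag_of c2)
  | While r c => while_frag (track r) (frag_of c)
  end.

Definition holds_regs (W : nat) (L : seq {set 'I_k.+1}) (s : nat -> nat) : Prop :=
  [/\ size L <= W, ~~ nilp L & forall r, r <= k -> track_val (track r) L = s r].

Lemma track_neq r r' : r <= k -> r' <= k -> r' != r -> track r' != track r.
Proof. by move=> rk rk' nr; rewrite -val_eqE /= !inordK. Qed.

(** The bound on values becomes a bound on space here: counters up to [B] fit into W cells however
    long the program runs. *)
Lemma frag_of_runs B W c s s' : B < 2 ^ W -> exec B c s s' -> max_reg c <= k ->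
  forall L j, holds_regs W L s -> exists L' j', holds_regs W L' s' /\
    fr_runs W.+2 (Some (fr_start (frag_of c)), tape L j, 0) (None, tape L' j', 0).
Proof.
move=> BW; elim=> {c s s'} /=.
- move=> s _ L j [LW L0 Ls]; exists L, j; split; first by split.
  apply: FrStep; first by apply: tape_space_le => //; apply: leqW LW.
  case: L LW L0 Ls => [//|A L] LW _ _; exact: FrRefl.
- move=> r s sB rk L j [LW L0 Ls].
  have sW : size (incr_tracks (track r) L) <= W.
    by apply: size_incr_le => //; rewrite Ls //; apply: leq_ltn_trans BW.
  have [//|j' runs] := @inc_frag_runs _ (track r) W.+2 L j _ L0; first exact: leqW sW.
  exists (incr_tracks (track r) L), j'; split=> //; split=> // [|r' rk'].
    by rewrite /nilp -!lt0n in L0 *; apply: leq_trans L0 (size_incr _ _).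
  rewrite /upd; case: eqVneq => [->|nr]; first by rewrite track_val_incr Ls.
  by rewrite track_val_incr_neq ?Ls // track_neq.
- move=> r s s0 rk L j [LW L0 Ls].
  have runs := @dec_frag_runs _ (track r) W.+2 L j.
  exists (decr_tracks (track r) L), j; split; last first.
    by apply: runs; [exact: leqW LW | rewrite Ls].
  split=> [||r' rk']; rewrite /nilp ?size_decr //.
  rewrite /upd; case: eqVneq => [->|nr]; first by rewrite track_val_decr Ls.
  by rewrite track_val_decr_neq ?Ls // track_neq.
- move=> c1 c2 s1 s2 s3 _ IH1 _ IH2; rewrite geq_max => /andP[k1 k2] L j h1.
  have [L2 [j2 [h2 r2]]] := IH1 k1 L j h1.
  have [L3 [j3 [h3 r3]]] := IH2 k2 L2 j2 h2.
  by exists L3, j3; split=> //; apply: seq_frag_runs r2 r3.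
- move=> r c s s0; rewrite geq_max => /andP[rk _] L j [LW L0 Ls].
  have [|//|j' runs] := @while_frag_test _ (track r) (frag_of c) W.+2 L j; first exact: leqW LW.
  by exists L, j'; split; [split | move: runs; rewrite Ls // s0 eqxx].
move=> r c s1 s2 s3 s0 _ IH1 _ IH2 rck L j [LW L0 Ls].
have := rck; rewrite geq_max => /andP[rk ck].
have [|//|j' runs] := @while_frag_test _ (track r) (frag_of c) W.+2 L j; first exact: leqW LW.
move: runs; rewrite Ls // -lt0n s0 => runs.
have [|L2 [j2 [h2 r2]]] := IH1 ck L j'; first by split.
have [L3 [j3 [h3 r3]]] := IH2 rck L2 j2 h2.
exists L3, j3; split=> //; apply: fr_runs_trans runs _; apply: fr_runs_trans r3.
apply: (@fr_runs_map _ _ (while_frag (track r) (frag_of c)) inr (Some (inl None)) _ _ _ _ r2).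
by move=> s g /=; case: (fr_delta s g) => [[[?|] ?] ?].
Qed.

(* Once the fragment exits, bit 0 of register [res] decides: acceptance costs one more step. *)
Definition tm_of (F : frag 'I_k.+1) (res : nat) : TM :=
  @MkTM (fr_st F + bool)%type (sym 'I_k.+1) None (input_sym ord0) (inl (fr_start F))
    (fun s g =>
       match s with
       | inl s => let: (o, g', d) := fr_delta s g in
                  Some (if o is Some s' then inl s' else inr false, g', d)
       | inr false => if g is Some (_, A) then
                        if track res \in A then Some (inr true, g, DS) else None
                      else None
       | inr true => None
       end)
    (fun s => s == inr true).

End Compile.

Section HaltingRuns.
Variable M : TM.

Inductive halt_runs (W : nat) : config M -> config M -> Prop :=
  | HaltNow c : tm_step M c = None -> cfg_space M c <= W -> halt_runs W c c
  | HaltStep c c1 cf : tm_step M c = Some c1 -> cfg_space M c <= W ->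
      halt_runs W c1 cf -> halt_runs W c cf.

Lemma tm_runS n c : tm_run M n.+1 c = obind (tm_run M n) (tm_step M c).
Proof.
elim: n => [|n IH] /=; first by case: (tm_step M c).
by rewrite -[tm_run M n.+1 c]/(obind (tm_step M) (tm_run M n c)) in IH *; rewrite IH; case: (tm_step M c).
Qed.

(** The machine is deterministic, so one halting run already yields halting, the space bound for
    every reachable configuration, and uniqueness of the halting configuration. *)
Lemma halt_runsP W c cf : halt_runs W c cf ->
  [/\ exists n, tm_run M n c = Some cf, tm_step M cf = None,
      forall n c', tm_run M n c = Some c' -> cfg_space M c' <= W
    & forall n c', tm_run M n c = Some c' -> tm_step M c' = None -> c' = cf].
Proof.
elim=> {c cf} [c st sp|c c1 cf st sp _ [[n rn] sf spn un]].
  split=> //; first by exists 0.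
    by case=> [|n] c'; [case=> <- | rewrite tm_runS st].
  by case=> [|n] c'; [case=> <- | rewrite tm_runS st].
split=> //; first by exists n.+1; rewrite tm_runS st.
  by case=> [|m] c'; [case=> <- | rewrite tm_runS st; apply: spn].
case=> [|m] c'; last by rewrite tm_runS st; apply: un.
by case=> <-; rewrite st.
Qed.

End HaltingRuns.

Lemma fr_runs_halt k (F : frag 'I_k.+1) res W c cf :
  fr_runs W c cf -> cf.1.1 = None ->
  let emb (o : option (fr_st F)) : tm_st (tm_of F res) := if o is Some s then inl s else inr false in
  forall ch, @halt_runs (tm_of F res) W (inr false, cf.1.2, cf.2) ch ->
  @halt_runs (tm_of F res) W (emb c.1.1, c.1.2, c.2) ch.
Proof.
elim=> {c cf} [c c0|s tp h c sp _ IH /IH{}IH] /= ch; first by rewrite c0.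
move/IH => {}IH; apply: (HaltStep (c1 := _)) IH => //.
rewrite /tm_step /fr_step /=.
by case: (fr_delta s _) => [[o g] []].
Qed.

(** The first bit of the input is the least significant digit. The leading 1 keeps inputs apart that
    differ only by zeros at the end, and gives the lower bound 2 ^ size x, through which quantities
    of the instance are compared with the code. *)
Definition code_bits (x : seq bool) : nat := foldr (fun (b : bool) acc => b + acc.*2) 1 x.

Lemma code_bits_lt x : code_bits x < 2 ^ (size x).+1.
Proof. elim: x => [//|b x IH] /=; rewrite expnS; case: b => /=; lia. Qed.

Lemma code_bits_ge x : 2 ^ size x <= code_bits x.
Proof. elim: x => [//|b x IH] /=; rewrite expnS; case: b => /=; lia. Qed.

Lemma track_val_input k r x : r <= k ->
  track_val (track k r) (rcons (input_tracks ord0 x) [set ord0]) = if r == 0 then code_bits x else 0.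
Proof.
move=> rk; have e0 : (track k r == ord0) = (r == 0) by rewrite -val_eqE /= inordK.
elim: x => [|b x IH] /=; first by rewrite inE e0; case: eqP.
by rewrite IH; case: b; rewrite ?inE ?e0; case: (r == 0).
Qed.

Theorem tm_of_cmd (c : cmd) (res : nat) : exists M : TM,
  forall x B W s', x != [::] -> size x < W -> B < 2 ^ W ->
  exec B c (fun i => if i == 0 then code_bits x else 0) s' -> s' res <= 1 ->
  [/\ tm_halts M x, tm_space_bounded M x W.+3 & (tm_accepts M x <-> s' res = 1)].
Proof.
(* The number of tracks depends on the program only, so one machine serves all inputs and all bounds
   [B] and [W]. *)
pose k := maxn res (max_reg c).
exists (tm_of (seq_frag (load_frag (@ord0 k)) (frag_of k c)) res).
move=> x B W s' x0 xW BW ex s1; set F := seq_frag _ _; set M := tm_of _ _.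
have [||L' [j' [[LW' L0' Ls'] runs]]] :=
   @frag_of_runs k B W c _ _ BW ex _ (rcons (input_tracks ord0 x) [set ord0]) false.
- exact: leq_maxr.
- split=> [||r rk]; rewrite ?/nilp ?size_rcons ?size_map //.
  by rewrite track_val_input.
have loadr : fr_runs W.+3 (Some (fr_start (load_frag (@ord0 k))), map (input_sym ord0) x, 0)
               (None, tape (rcons (input_tracks ord0 x) [set ord0]) false, 0).
  by apply: load_frag_runs => //; lia.
have runs' : fr_runs W.+3 (Some (fr_start (frag_of k c)),
   tape (rcons (input_tracks ord0 x) [set ord0]) false, 0) (None, tape L' j', 0).
  elim: runs => [*|s tp h d sp _ IH]; first exact: FrRefl.
  by apply: FrStep IH; lia.
have all_runs := seq_frag_runs loadr runs'.
have [ch hr ca] : exists2 ch, @halt_runs M W.+3 (inr false, tape L' j', 0) ch &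
    tm_acc M ch.1.1 = (s' res == 1).
  have sr : track_val (track k res) L' = s' res by apply: Ls'; apply: leq_maxl.
  case: L' L0' {runs runs' all_runs} LW' sr {Ls'} => [//|A L] _ LW /= sr.
  have sp b : cfg_space M (b, tape (A :: L) j', 0) <= W.+3.
    by apply: (@tape_space_le _ (A :: L) j' 0 W.+3) => //=; rewrite ltnS; apply: leq_trans LW _; lia.
  case tA: (track k res \in A) sr => /= sr.
  - exists (inr true, tape (A :: L) j', 0); last by rewrite eqxx; move: s1; rewrite -sr; case: (track_val _ _).
    have st : tm_step M (inr false, tape (A :: L) j', 0) = Some (inr true, tape (A :: L) j', 0).
      by rewrite /= tA.
    by apply: HaltStep st (sp _) _; apply: HaltNow.
  exists (inr false, tape (A :: L) j', 0); last by move: s1; rewrite -sr; case: (track_val _ _).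
  by apply: HaltNow => //=; rewrite tA.
have := fr_runs_halt all_runs erefl hr.
rewrite -[(_, _, _)]/(tm_init M x) => /halt_runsP[[n rn] sf spn un].
split; first by exists n, ch.
  exact: spn.
split=> [[m [c' [rm st acc]]]|sr]; last by exists n, ch; split=> //; rewrite ca sr.
by move: acc; rewrite (un _ _ rm st) ca => /eqP.
Qed.

(** * Subroutine calls on a stack of registers *)

Lemma exec_mono B B' c s s' : B <= B' -> exec B c s s' -> exec B' c s s'.
Proof.
move=> BB'; elim=> {c s s'}; try by econstructor; eauto.
by move=> r s sB; constructor; apply: leq_trans BB'.
Qed.

Fixpoint shift (b : nat) (c : cmd) : cmd :=
  match c with
  | Skip => Skip
  | Inc r => Inc (b + r)
  | Dec r => Dec (b + r)
  | Seq c1 c2 => Seq (shift b c1) (shift b c2)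
  | While r c => While (b + r) (shift b c)
  end.

(** The caller's frame [t] below register b, the callee's registers [s] above it; [exec_shift] is
    the corresponding frame rule. *)
Definition glue (b : nat) (t s : nat -> nat) : nat -> nat :=
  fun i => if i < b then t i else s (i - b).

Lemma glue_add b t s r : glue b t s (b + r) = s r.
Proof. by rewrite /glue ltnNge leq_addr addKn. Qed.

Lemma upd_glue b t s r v : upd (glue b t s) (b + r) v = glue b t (upd s r v).
Proof.
apply: functional_extensionality => i; rewrite /upd /glue.
case: ltnP => ib; first by rewrite ltn_eqF // ltn_addr.
by rewrite -(eqn_add2l b (i - b)) subnKC.
Qed.

Lemma exec_shift B c s s' b t : exec B c s s' ->
  exec B (shift b c) (glue b t s) (glue b t s').
Proof.
elim=> {c s s'} /=.
- by move=> s; constructor.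
- by move=> r s sB; rewrite -upd_glue -(glue_add b t s r); constructor; rewrite glue_add.
- by move=> r s s0; rewrite -upd_glue -(glue_add b t s r); constructor; rewrite glue_add.
- by move=> c1 c2 s1 s2 s3 _ IH1 _ IH2; apply: ExSeq IH1 IH2.
- by move=> r c s s0; apply: ExWhile0; rewrite glue_add.
by move=> r c s1 s2 s3 s0 _ IH1 _ IH2; apply: ExWhileS IH1 IH2; rewrite glue_add.
Qed.

(* Register files are written as lists: register [i] holds item [i], and all
   registers beyond the list are zero. *)
Definition regs (l : seq nat) : nat -> nat := nth 0 l.

Lemma glue_regs l1 l2 : glue (size l1) (regs l1) (regs l2) = regs (l1 ++ l2).
Proof. by apply: functional_extensionality => i; rewrite /glue /regs nth_cat. Qed.

Lemma regs_cat0 l m : regs (l ++ nseq m 0) = regs l.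
Proof.
apply: functional_extensionality => i; rewrite /regs nth_cat nth_nseq if_same.
by case: ltnP => // ?; rewrite nth_default.
Qed.

Lemma upd_regs l1 x l2 v : upd (regs (l1 ++ x :: l2)) (size l1) v = regs (l1 ++ v :: l2).
Proof.
apply: functional_extensionality => i; rewrite /upd /regs !nth_cat.
case: ltngtP => [//|lt|->]; last by rewrite subnn.
by rewrite -(subnSK lt).
Qed.

Lemma regs_at l1 x l2 : regs (l1 ++ x :: l2) (size l1) = x.
Proof. by rewrite /regs nth_cat ltnn subnn. Qed.

Lemma upd_upd s r v w : upd (upd s r v) r w = upd s r w.
Proof. by apply: functional_extensionality => i; rewrite /upd; case: eqP. Qed.

Lemma upd_id s r : upd s r (s r) = s.
Proof. by apply: functional_extensionality => i; rewrite /upd; case: eqP => // ->. Qed.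

Definition clear (r : nat) : cmd := While r (Dec r).

Lemma exec_clear B r s : exec B (clear r) s (upd s r 0).
Proof.
move en: (s r) => n; elim: n s en => [|n IH] s en.
  by rewrite -[in upd _ _ _]en upd_id; apply: ExWhile0.
apply: (@ExWhileS _ _ _ _ (upd s r n)); first by rewrite en.
  by rewrite -[n]/(n.+1.-1) -en; constructor; rewrite en.
by rewrite -(upd_upd s r n 0); apply: IH; rewrite /upd eqxx.
Qed.

Definition move_reg (r d : nat) : cmd := While r (Seq (Dec r) (Inc d)).

Lemma exec_move B r d s : r != d -> s r + s d <= B ->
  exec B (move_reg r d) s (upd (upd s d (s r + s d)) r 0).
Proof.
move=> rd; move en: (s r) => n; elim: n s en => [|n IH] s en leB.
  by rewrite add0n upd_id -[in upd _ _ _]en upd_id; apply: ExWhile0.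
have dr : (d == r) = false by rewrite eq_sym; apply/negbTE.
pose s2 := upd (upd s r n) d (s d).+1.
apply: (@ExWhileS _ _ _ _ s2); first by rewrite en.
  apply: (@ExSeq _ _ _ _ (upd s r n)).
    by rewrite -[n]/(n.+1.-1) -en; constructor; rewrite en.
  have e : upd s r n d = s d by rewrite /upd dr.
  by rewrite /s2 -e; constructor; rewrite e; lia.
have -> : upd (upd s d (n.+1 + s d)) r 0 = upd (upd s2 d (n + s2 d)) r 0.
  apply: functional_extensionality => i; rewrite /s2 /upd eqxx.
  by case: eqP => // _; case: eqP => // _; lia.
by apply: IH; rewrite /s2 /upd ?eqxx ?(negbTE rd) ?eqxx //; lia.
Qed.

(** Reading a counter destroys it, so [r] is emptied into both [d] and the scratch register [t], and
    then refilled from [t]. *)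
Definition copy_reg (r d t : nat) : cmd :=
  Seq (While r (Seq (Dec r) (Seq (Inc d) (Inc t)))) (move_reg t r).

Lemma exec_copy B r d t s : r != d -> r != t -> d != t -> s t = 0 -> s d = 0 -> s r <= B ->
  exec B (copy_reg r d t) s (upd s d (s r)).
Proof.
move=> /negbTE rd /negbTE rt /negbTE dt st sd srB.
have [dr tr td] : [/\ (d == r) = false, (t == r) = false & (t == d) = false].
  by rewrite ![_ == r]eq_sym (eq_sym t).
pose s1 := upd (upd (upd s d (s r)) t (s r)) r 0.
apply: (@ExSeq _ _ _ _ s1); last first.
  have -> : upd s d (s r) = upd (upd s1 r (s1 t + s1 r)) t 0.
    apply: functional_extensionality => i; rewrite /s1 /upd !eqxx tr.
    case: (eqVneq i d) => [->|nid]; first by rewrite dt dr.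
    case: (eqVneq i t) => [->|nit]; first by [].
    by case: eqP => // ->; lia.
  by apply: exec_move; rewrite ?tr // /s1 /upd !eqxx tr addn0.
(* The loop invariant needs arbitrary contents of [d] and [t], since both grow as the loop
   proceeds. *)
suff gen n s0 : s0 r = n -> n + s0 d <= B -> n + s0 t <= B ->
    exec B (While r (Seq (Dec r) (Seq (Inc d) (Inc t)))) s0
      (upd (upd (upd s0 d (n + s0 d)) t (n + s0 t)) r 0).
  by have := gen _ s erefl; rewrite sd st !addn0; apply.
rewrite {s st sd srB}/s1; move: s0 => s en.
elim: n s en => [|n IH] s en leB leB'.
  by rewrite !add0n !upd_id -[in upd _ _ _]en upd_id; apply: ExWhile0.
pose s1 := upd s r n; pose s2 := upd s1 d (s d).+1; pose s3 := upd s2 t (s t).+1.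
apply: (@ExWhileS _ _ _ _ s3); first by rewrite en.
  apply: (@ExSeq _ _ _ _ s1).
    by rewrite /s1 -[n]/(n.+1.-1) -en; constructor; rewrite en.
  have e1 : s1 d = s d by rewrite /s1 /upd dr.
  have e2 : s2 t = s t by rewrite /s2 /s1 /upd tr td.
  apply: (@ExSeq _ _ _ _ s2).
    by rewrite /s2 -e1; constructor; rewrite e1; lia.
  by rewrite /s3 -e2; constructor; rewrite e2; lia.
have -> : upd (upd (upd s d (n.+1 + s d)) t (n.+1 + s t)) r 0 =
          upd (upd (upd s3 d (n + s3 d)) t (n + s3 t)) r 0.
  apply: functional_extensionality => i; rewrite /s3 /s2 /s1 /upd !eqxx dt.
  case: eqP => // _; case: eqP => [_|_]; first by lia.
  by case: eqP => // _; lia.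
apply: IH; rewrite /s3 /s2 /s1 /upd ?eqxx ?dt ?rt ?rd ?eqxx //; lia.
Qed.

Lemma exec_copy_push B l x : x < size l -> nth 0 l x <= B ->
  exec B (copy_reg x (size l) (size l).+1) (regs l) (regs (rcons l (nth 0 l x))).
Proof.
move=> xl xB.
have -> : regs (rcons l (nth 0 l x)) = upd (regs l) (size l) (regs l x).
  apply: functional_extensionality => i; rewrite /regs /upd nth_rcons.
  by case: ltngtP => // lt; rewrite nth_default // ltnW.
by apply: exec_copy => //; rewrite ?(ltn_eqF xl) ?(ltn_eqF (ltnW xl)) /regs ?nth_default //;
  rewrite -?(gtn_eqF (ltnSn _)); lia.
Qed.

Fixpoint copies (xs : seq nat) (b : nat) : cmd :=
  if xs is x :: xs' then Seq (copy_reg x b b.+1) (copies xs' b.+1) else Skip.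

Lemma exec_copies B xs l ys : all (fun x => x < size l) xs -> all (fun x => nth 0 l x <= B) xs ->
  exec B (copies xs (size (l ++ ys))) (regs (l ++ ys)) (regs ((l ++ ys) ++ map (nth 0 l) xs)).
Proof.
elim: xs ys => [|x xs IH] ys /=; first by rewrite cats0; constructor.
move=> /andP[xl xsl] /andP[xB xsB].
have e : nth 0 (l ++ ys) x = nth 0 l x by rewrite nth_cat xl.
apply: ExSeq; first apply: exec_copy_push.
- by rewrite size_cat ltn_addr.
- by rewrite e.
rewrite e -(size_rcons _ (nth 0 l x)) rcons_cat -cat_rcons rcons_cat; exact: IH.
Qed.

Fixpoint clears (b m : nat) : cmd :=
  if m is m'.+1 then Seq (clear b) (clears b.+1 m') else Skip.

Lemma exec_clears B l1 ys l2 :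
  exec B (clears (size l1) (size ys)) (regs (l1 ++ ys ++ l2))
    (regs (l1 ++ nseq (size ys) 0 ++ l2)).
Proof.
elim: ys l1 => [|y ys IH] l1 /=; first by constructor.
apply: ExSeq; first exact: exec_clear.
by rewrite upd_regs -(size_rcons l1 0) -!cat_rcons.
Qed.

Lemma exec_move_down B l1 x l2 : x <= B ->
  exec B (move_reg (size l1 + (size l2).+1) (size l1)) (regs (l1 ++ 0 :: l2 ++ [:: x]))
    (regs (l1 ++ x :: l2)).
Proof.
move=> xB; set s := regs _.
have s1 : s (size l1) = 0 by rewrite /s regs_at.
have s2 : s (size l1 + (size l2).+1) = x.
  by rewrite /s /regs -cat_rcons catA -addSnnS -(size_rcons l1 0) -size_cat -/(regs _) regs_at.
have -> : regs (l1 ++ x :: l2) =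
    upd (upd s (size l1) (s (size l1 + (size l2).+1) + s (size l1))) (size l1 + (size l2).+1) 0.
  rewrite s1 s2 addn0 /s upd_regs -addSnnS -(size_rcons l1 x) -size_cat.
  by rewrite -!(cat_rcons x l1) catA upd_regs (regs_cat0 _ 1).
by apply: exec_move; rewrite ?s1 ?s2 ?addn0 //; lia.
Qed.

(** Register b is kept free for the result. The callee works on copies of the arguments placed above
    it; afterwards its result is moved down to b and the copies are erased, so that all registers
    beyond the stack are zero again, as the next call expects. *)
Definition push_call (xs : seq nat) (b : nat) (c : cmd) : cmd :=
  Seq (copies xs b.+1) (Seq (shift b.+1 c)
    (Seq (move_reg (b + (size xs).+1) b) (clears b.+1 (size xs)))).

Lemma exec_push_call B xs l c y : let args := map (nth 0 l) xs in
  all (fun x => x < size l) xs -> all (fun x => x <= B) args -> y <= B ->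
  exec B c (regs args) (regs (rcons args y)) ->
  exec B (push_call xs (size l) c) (regs l) (regs (rcons l y)).
Proof.
move=> args xsl argB yB ex.
apply: (@ExSeq _ _ _ _ (regs ((l ++ [:: 0]) ++ args))).
  rewrite -[in X in exec _ _ X _](regs_cat0 l 1) -[(size l).+1]addn1.
  rewrite -[_ + 1]/(size l + size [:: 0]) -size_cat.
  by apply: exec_copies => //; move: argB; rewrite /args all_map.
apply: (@ExSeq _ _ _ _ (regs (l ++ 0 :: args ++ [:: y]))).
  rewrite -[(size l).+1]addn1 -[_ + 1]/(size l + size [:: 0]) -size_cat.
  have -> : l ++ 0 :: args ++ [:: y] = (l ++ [:: 0]) ++ rcons args y by rewrite -cats1 -catA.
  by rewrite -!glue_regs; apply: exec_shift.
apply: (@ExSeq _ _ _ _ (regs (l ++ y :: args))).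
  by rewrite -(size_map (nth 0 l) xs); apply: exec_move_down.
have := @exec_clears B (rcons l y) args [::].
by rewrite !cats0 regs_cat0 size_rcons cat_rcons size_map.
Qed.

Definition set_reg (d b : nat) : cmd := Seq (clear d) (move_reg b d).

Lemma exec_set_reg B l1 x l2 y : y <= B ->
  exec B (set_reg (size l1) (size l1 + (size l2).+1)) (regs (l1 ++ x :: rcons l2 y))
    (regs (l1 ++ y :: l2)).
Proof.
move=> yB; apply: ExSeq; first exact: exec_clear.
by rewrite upd_regs -cats1; apply: exec_move_down.
Qed.

(** * Functions computable in polynomial space *)

Definition small (L : nat) (l : seq nat) : bool := all (fun x => x < 2 ^ L) l.

(** The base L + 2 exceeds 1, so the bound is monotone in [a] and a single exponent can stand for
    any polynomial. *)
Definition pbound (a L : nat) : nat := 2 ^ ((L + 2) ^ a).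

(** The calling convention: the arguments survive, the result is appended, and all scratch registers
    return to zero. One exponent bounds both the result and the intermediate values. *)
Definition pscmd (n : nat) (f : seq nat -> nat) (c : cmd) (a : nat) : Prop :=
  forall L l, size l = n -> small L l ->
  f l < pbound a L /\ exec (pbound a L) c (regs l) (regs (rcons l (f l))).

(* Space is measured in binary digits, so registers may reach 2 ^ poly(L). *)
Definition psfun (n : nat) (f : seq nat -> nat) : Prop := exists c a, pscmd n f c a.

Definition psbounded (n : nat) (u : seq nat -> nat) : Prop :=
  exists a, forall L l, size l = n -> small L l -> u l < pbound a L.

Lemma leq_pbound a b L : a <= b -> pbound a L <= pbound b L.
Proof. by move=> ab; rewrite /pbound !leq_pexp2l // addn2. Qed.

(** Polynomials are closed under substitution. The 2 added to a absorbs the shift of the inner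
    bound: (L + 2) ^ a + 2 is at most (L + 2) ^ (a + 2). *)
Lemma pbound_comp a b L : pbound b ((L + 2) ^ a) <= pbound ((a + 2) * b) L.
Proof.
rewrite /pbound leq_pexp2l // expnM; case: b => [//|b]; rewrite leq_exp2r // expnD.
have : 0 < (L + 2) ^ a by rewrite expn_gt0 addn2.
by set x := (L + 2) ^ a => x0; rewrite expnS expn1; nia.
Qed.

Lemma leq_exp2_pbound a L : 0 < a -> 2 ^ L <= pbound a L.
Proof.
move=> a0; rewrite /pbound leq_pexp2l //.
by apply: (@leq_trans ((L + 2) ^ 1)); rewrite ?leq_pexp2l ?addn2 // expn1; lia.
Qed.

Lemma pscmd_mono n f c a b : a <= b -> pscmd n f c a -> pscmd n f c b.
Proof.
move=> ab H L l sl ll; have [fl ex] := H L l sl ll; split.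
  exact: leq_trans fl (leq_pbound _ ab).
exact: exec_mono (leq_pbound _ ab) ex.
Qed.

Lemma small_le L l : small L l -> all (fun x => x <= 2 ^ L) l.
Proof. by apply: sub_all => x /ltnW. Qed.

Lemma pscmd_push n f c a xs l L : 0 < a -> pscmd n f c a -> size xs = n ->
  all (fun x => x < size l) xs -> small L (map (nth 0 l) xs) ->
  exec (pbound a L) (push_call xs (size l) c) (regs l) (regs (rcons l (f (map (nth 0 l) xs)))).
Proof.
move=> a0 H sx xl ll; have [|fl ex] := H L _ _ ll; first by rewrite size_map.
apply: exec_push_call => //; last exact: ltnW.
by apply: sub_all (small_le ll) => x /leq_trans; apply; apply: leq_exp2_pbound.
Qed.

Lemma small_cat L l1 l2 : small L (l1 ++ l2) = small L l1 && small L l2.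
Proof. exact: all_cat. Qed.

Lemma map_nth_iota_cat (l1 l2 : seq nat) : map (nth 0 (l1 ++ l2)) (iota 0 (size l1)) = l1.
Proof.
apply: (@eq_from_nth _ 0); rewrite size_map size_iota // => i il.
by rewrite (nth_map 0) ?size_iota // nth_iota // nth_cat il.
Qed.

Lemma psfun_list n (gs : seq (seq nat -> nat)) :
  (forall i, i < size gs -> psfun n (nth (fun=> 0) gs i)) ->
  exists c a, forall L l, size l = n -> small L l ->
    small ((L + 2) ^ a) [seq g l | g <- gs] /\
    exec (pbound a L) c (regs l) (regs (l ++ [seq g l | g <- gs])).
Proof.
elim/last_ind: gs => [|gs g IH] H.
  by exists Skip, 0 => L l _ _; rewrite cats0; split=> //; constructor.
have [|c1 [a1 H1]] := IH.
  move=> i ig; have := H i; rewrite size_rcons nth_rcons ig; apply; exact: ltnW.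
have := H (size gs); rewrite size_rcons nth_rcons ltnn eqxx => /(_ (ltnSn _)) [c2 [a2 H2]].
pose a := (maxn a1 a2).+1.
exists (Seq c1 (push_call (iota 0 n) (n + size gs) c2)), a => L l sl ll.
have [sm1 ex1] := H1 L l sl ll; have [sm2 ex2] := H2 L l sl ll.
have la1 : a1 <= a by rewrite leqW ?leq_maxl.
have la2 : a2 <= a by rewrite leqW ?leq_maxr.
split.
  rewrite map_rcons -cats1 small_cat /= andbT; apply/andP; split.
    by apply: sub_all sm1 => x /leq_trans; apply; apply: leq_pbound.
  by apply: leq_trans sm2 _; apply: leq_pbound.
apply: ExSeq; first exact: exec_mono (leq_pbound _ la1) ex1.
rewrite map_rcons -rcons_cat.
have := @pscmd_push n g c2 a (iota 0 n) (l ++ [seq g l | g <- gs]) L isT (pscmd_mono la2 H2).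
have := map_nth_iota_cat l [seq g l | g <- gs]; rewrite sl => ->.
rewrite size_cat size_map sl; apply=> //; first by rewrite size_iota.
by apply/allP => i; rewrite mem_iota => /andP[_ /=]; apply: ltn_addr.
Qed.

Lemma psfun_comp n f (gs : seq (seq nat -> nat)) : psfun (size gs) f ->
  (forall i, i < size gs -> psfun n (nth (fun=> 0) gs i)) ->
  psfun n (fun l => f [seq g l | g <- gs]).
Proof.
move=> [cf [af Hf]] /psfun_list [cg [ag Hg]].
pose a := maxn ag.+1 ((ag + 2) * af.+1).
have aga : ag <= a by rewrite ltnW // leq_maxl.
set m := size gs.
exists (Seq cg (Seq (push_call (iota n m) (n + m) cf)
         (* Without intermediate values the result already sits in register n, and [move_reg] from a
            nonzero register to itself would loop forever. *)
         (if m is 0 then Skip else Seq (clears n m) (move_reg (n + m) n)))), a => L l sl ll.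
have [smg exg] := Hg L l sl ll.
set vs := [seq g l | g <- gs] in smg exg *.
have svs : size vs = m by rewrite size_map.
have Bf : pbound af.+1 ((L + 2) ^ ag) <= pbound a L.
  by apply: leq_trans (pbound_comp _ _ _) (leq_pbound _ (leq_maxr _ _)).
have [fv _] := pscmd_mono (leqnSn af) Hf svs smg.
have fB := leq_trans fv Bf; split=> //.
apply: ExSeq; first exact: exec_mono (leq_pbound _ aga) exg.
have ev : map (nth 0 (l ++ vs)) (iota n m) = vs.
  apply: (@eq_from_nth _ 0); rewrite size_map size_iota // => i im.
  rewrite (nth_map 0) ?size_iota // nth_iota // nth_cat sl ltnNge leq_addr /=.
  by rewrite addKn.
apply: (@ExSeq _ _ _ _ (regs (rcons (l ++ vs) (f vs)))).
  apply: (exec_mono Bf).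
  have := @pscmd_push m f cf af.+1 (iota n m) (l ++ vs) _ isT (pscmd_mono (leqnSn af) Hf).
  rewrite ev size_cat sl svs; apply=> //; first by rewrite size_iota.
  by apply/allP => i; rewrite mem_iota => /andP[_].
rewrite -svs; case: vs svs {ev exg smg fv} fB => [|v vs] svs fB; first by rewrite cats0; constructor.
apply: (@ExSeq _ _ _ _ (regs (l ++ nseq (size (v :: vs)) 0 ++ [:: f (v :: vs)]))).
  by rewrite -cats1 -catA -sl; apply: exec_clears.
have := @exec_move_down (pbound a L) l (f (v :: vs)) (nseq (size vs) 0) (ltnW fB).
by rewrite size_nseq sl -(cat_rcons (f (v :: vs)) l) regs_cat0.
Qed.

Lemma psfun_ext n f g : psfun n f -> (forall l, size l = n -> f l = g l) -> psfun n g.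
Proof.
by move=> [c [a H]] fg; exists c, a => L l sl ll; rewrite -fg //; apply: H.
Qed.

Lemma psfun_bounded n f : psfun n f -> psbounded n f.
Proof. by move=> [c [a H]]; exists a => L l sl ll; case: (H L l sl ll). Qed.

Lemma psfun_nth n i : i < n -> psfun n (fun l => nth 0 l i).
Proof.
move=> ni; exists (copy_reg i n n.+1), 1 => L l sl ll.
have lt : nth 0 l i < 2 ^ L by apply: (allP ll); rewrite mem_nth // sl.
have lt2 := leq_trans lt (leq_exp2_pbound L (ltnSn 0)).
by split=> //; rewrite -sl; apply: exec_copy_push; [rewrite sl | apply: ltnW].
Qed.

Lemma psfun_zero n : psfun n (fun=> 0).
Proof.
exists Skip, 0 => L l _ _; split; first by rewrite expn_gt0.
by rewrite -cats1 (regs_cat0 l 1); constructor.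
Qed.

Lemma psfun_succ_var : psfun 1 (fun l => (nth 0 l 0).+1).
Proof.
exists (Seq (copy_reg 0 1 2) (Inc 1)), 1 => L [|x [|//]] // _; rewrite /small /= andbT => xL.
have xB : x.+1 < pbound 1 L.
  apply: (@leq_trans (2 ^ L.+1)); first by rewrite expnS; lia.
  by rewrite /pbound leq_pexp2l // expn1; lia.
split=> //; apply: ExSeq; first by apply: (@exec_copy_push _ [:: x] 0) => //=; lia.
have -> : regs [:: x; x.+1] = upd (regs [:: x; x]) 1 (regs [:: x; x] 1).+1.
  by rewrite (@upd_regs [:: x] x [::]).
by constructor => /=; apply: ltnW.
Qed.

(** The number of rounds may be exponential, since only space counts. The bound [u] on all partial
    results is essential: repeated squaring would otherwise leave the class. *)
Lemma psfun_rec n (m g h u : seq nat -> nat) :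
  psfun n m -> psfun n g -> psfun n.+2 h -> psbounded n u ->
  (forall l i, size l = n -> i <= m l ->
     iteri i (fun j acc => h [:: j, acc & l]) (g l) <= u l) ->
  psfun n (fun l => iteri (m l) (fun j acc => h [:: j, acc & l]) (g l)).
Proof.
move=> [cm [am Hm]] [cg [ag Hg]] [ch [ah Hh]] [au Hu] leu.
(* The index and the accumulator passed to [h] have up to (L + 2) ^ A digits, so the cost of [h] is
   a composed polynomial as in [pbound_comp]. *)
pose A := (maxn (maxn am ag) au).+1; pose E := maxn A ((A + 2) * ah.+1).
have [amA agA auA] : [/\ am <= A, ag <= A & au <= A] by rewrite /A; split; lia.
have AE : A <= E by rewrite leq_maxl.
(* Register n counts the remaining rounds, n + 1 holds the index and n + 2 the accumulator. *)
pose body := Seq (Dec n) (Seq (push_call [:: n.+1, n.+2 & iota 0 n] n.+3 ch)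
                         (Seq (set_reg n.+2 n.+3) (Inc n.+1))).
exists (Seq (push_call (iota 0 n) n cm) (Seq (push_call (iota 0 n) n.+2 cg)
  (Seq (While n body) (Seq (clears n 2) (move_reg n.+2 n))))), E => L l sl ll.
set F := fun j acc => h [:: j, acc & l].
have uA : u l < pbound A L by apply: leq_trans (Hu _ _ sl ll) (leq_pbound _ auA).
have uE : u l < pbound E L by apply: leq_trans uA (leq_pbound _ AE).
have leuE i : i <= m l -> iteri i F (g l) < pbound E L.
  by move=> im; apply: leq_ltn_trans (leu l i sl im) uE.
split; first exact: leuE.
have [mB _] := pscmd_mono (leq_trans amA AE) Hm sl ll.
have all_iota l2 : all (fun x => x < size (l ++ l2)) (iota 0 n).
  by apply/allP => i; rewrite mem_iota size_cat sl => /andP[_ /=]; apply: ltn_addr.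
have E0 : 0 < E by apply: leq_trans AE.
apply: (@ExSeq _ _ _ _ (regs (l ++ [:: m l; 0]))).
  rewrite -cat_rcons (regs_cat0 _ 1).
  have := @pscmd_push n m cm E (iota 0 n) l L E0 (pscmd_mono (leq_trans amA AE) Hm).
  have := map_nth_iota_cat l [::]; rewrite cats0 sl => ->; apply=> //.
    by rewrite size_iota.
  by have := all_iota [::]; rewrite cats0 sl.
apply: (@ExSeq _ _ _ _ (regs (l ++ [:: m l; 0; g l]))).
  have := @pscmd_push n g cg E (iota 0 n) (l ++ [:: m l; 0]) L E0 (pscmd_mono (leq_trans agA AE) Hg).
  have := map_nth_iota_cat l [:: m l; 0]; rewrite sl => ->.
  rewrite size_cat sl addn2 rcons_cat; apply=> //; first by rewrite size_iota.
  by have := all_iota [:: m l; 0]; rewrite size_cat sl addn2.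
apply: (@ExSeq _ _ _ _ (regs (l ++ [:: 0; m l; iteri (m l) F (g l)]))).
  suff gen k i : k + i = m l ->
      exec (pbound E L) (While n body) (regs (l ++ [:: k; i; iteri i F (g l)]))
        (regs (l ++ [:: 0; m l; iteri (m l) F (g l)])).
    by apply: (gen (m l) 0); rewrite addn0.
  elim: k i => [|k IH] i ki.
    by move: ki; rewrite add0n => ->; apply: ExWhile0; rewrite -sl regs_at.
  apply: ExWhileS (IH i.+1 _); last by lia.
    by rewrite -sl regs_at.
  set acc := iteri i F (g l).
  apply: (@ExSeq _ _ _ _ (regs (l ++ [:: k; i; acc]))).
    have -> : regs (l ++ [:: k; i; acc]) = upd (regs (l ++ [:: k.+1; i; acc])) n
                (regs (l ++ [:: k.+1; i; acc]) n).-1.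
      by rewrite -sl regs_at upd_regs.
    by constructor; rewrite -sl regs_at.
  apply: (@ExSeq _ _ _ _ (regs (l ++ [:: k; i; acc; F i acc]))).
    have mA : m l < pbound A L by apply: leq_trans (proj1 (Hm _ _ sl ll)) (leq_pbound _ amA).
    have := @pscmd_push n.+2 h ch ah.+1 [:: n.+1, n.+2 & iota 0 n] (l ++ [:: k; i; acc])
       ((L + 2) ^ A) isT (pscmd_mono (leqnSn _) Hh).
    have := map_nth_iota_cat l [:: k; i; acc]; rewrite sl /= => ->.
    have -> : nth 0 (l ++ [:: k; i; acc]) n.+1 = i by rewrite nth_cat sl ltnNge leqnSn subSnn.
    have -> : nth 0 (l ++ [:: k; i; acc]) n.+2 = acc.
      by rewrite nth_cat sl ltnNge leqW // -addn2 addKn.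
    rewrite rcons_cat /= size_cat sl addn3 => H.
    apply: exec_mono (H _ _ _).
    + by apply: leq_trans (pbound_comp _ _ _) (leq_pbound _ (leq_maxr _ _)).
    + by rewrite size_iota.
    + by have := all_iota [:: k; i; acc]; rewrite size_cat sl addn3 => ->; rewrite ltnS leqnSn ltnSn.
    apply/and3P; split.
    + by apply: leq_trans mA; lia.
    + by apply: leq_ltn_trans (leu l i sl _) uA; lia.
    apply: sub_all ll => x /leq_trans; apply; exact: leq_exp2_pbound.
  apply: (@ExSeq _ _ _ _ (regs (l ++ [:: k; i; F i acc]))).
    have := @exec_set_reg (pbound E L) (l ++ [:: k; i]) acc [::] (F i acc).
    rewrite -!catA /= size_cat sl addn2 addn1; apply.
    by rewrite -[F i acc]/(iteri i.+1 F (g l)); apply/ltnW/leuE; lia.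
  have -> : regs (l ++ [:: k; i.+1; iteri i.+1 F (g l)]) =
      upd (regs (l ++ [:: k; i; F i acc])) n.+1 (regs (l ++ [:: k; i; F i acc]) n.+1).+1.
    by rewrite -sl -(size_rcons l k) -!(cat_rcons k l) regs_at upd_regs.
  by constructor; rewrite -sl -(size_rcons l k) -cat_rcons regs_at; lia.
apply: (@ExSeq _ _ _ _ (regs (l ++ [:: 0; 0; iteri (m l) F (g l)]))).
  have := @exec_clears (pbound E L) l [:: 0; m l] [:: iteri (m l) F (g l)].
  by rewrite sl.
have := @exec_move_down (pbound E L) l (iteri (m l) F (g l)) [:: 0].
by rewrite sl addn2 -(cat_rcons (iteri _ _ _) l) (regs_cat0 _ 1); apply; apply: ltnW (leuE _ _).
Qed.

Inductive while_runs (cond step : nat -> nat) (U : nat) : nat -> nat -> Prop :=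
  | WhStop z : z <= U -> cond z = 0 -> while_runs cond step U z z
  | WhStep z z' : z <= U -> cond z != 0 -> while_runs cond step U (step z) z' ->
      while_runs cond step U z z'.

(** Termination is part of [while_runs], and no bound on the number of iterations is asked for.
    Register n holds the loop state and n + 1 its condition, which is zero on exit and needs no
    cleaning up. *)
Lemma psfun_while n (init cond step u F : seq nat -> nat) :
  psfun n init -> psfun n.+1 cond -> psfun n.+1 step -> psbounded n u ->
  (forall l, size l = n ->
     while_runs (fun z => cond (z :: l)) (fun z => step (z :: l)) (u l) (init l) (F l)) ->
  psfun n F.
Proof.
move=> [ci [ai Hi]] [cc [ac Hc]] [cs [as_ Hs]] [au Hu] Hw.
pose A := (maxn ai au).+1; pose E := maxn A ((A + 2) * (maxn ac as_).+1).
have [aiA auA] : ai <= A /\ au <= A by rewrite /A; split; lia.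
have AE : A <= E by rewrite leq_maxl.
have E0 : 0 < E by apply: leq_trans AE.
pose body := Seq (push_call (n :: iota 0 n) n.+2 cs) (Seq (set_reg n n.+2)
               (Seq (push_call (n :: iota 0 n) n.+2 cc) (set_reg n.+1 n.+2))).
exists (Seq (push_call (iota 0 n) n ci) (Seq (push_call (n :: iota 0 n) n.+1 cc)
          (While n.+1 body))), E => L l sl ll.
have uA : u l < pbound A L by apply: leq_trans (Hu _ _ sl ll) (leq_pbound _ auA).
have uE : u l < pbound E L by apply: leq_trans uA (leq_pbound _ AE).
have all_iota l2 : all (fun x => x < size (l ++ l2)) (iota 0 n).
  by apply/allP => i; rewrite mem_iota size_cat sl => /andP[_ /=]; apply: ltn_addr.
have call f cf af l2 z : af <= maxn ac as_ -> pscmd n.+1 f cf af -> z <= u l ->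
    f (z :: l) < pbound E L /\
    exec (pbound E L) (push_call (n :: iota 0 n) (n.+1 + size l2) cf)
      (regs (l ++ z :: l2)) (regs (rcons (l ++ z :: l2) (f (z :: l)))).
  move=> afm Hf zu; have {}Hf := pscmd_mono (leqW afm) Hf.
  have sm : small ((L + 2) ^ A) (z :: l).
    apply/andP; split; first exact: leq_ltn_trans uA.
    apply: sub_all ll => x /leq_trans; apply; exact: leq_exp2_pbound.
  have EB : pbound (maxn ac as_).+1 ((L + 2) ^ A) <= pbound E L.
    by apply: leq_trans (pbound_comp _ _ _) (leq_pbound _ (leq_maxr _ _)).
  split; first by apply: leq_trans EB; apply: (proj1 (Hf _ _ _ sm)); rewrite /= sl.
  apply: exec_mono EB _.
  have := @pscmd_push n.+1 f cf (maxn ac as_).+1 (n :: iota 0 n) (l ++ z :: l2) ((L + 2) ^ A) isT Hf.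
  have := map_nth_iota_cat l (z :: l2); rewrite sl /= => ->.
  have -> : nth 0 (l ++ z :: l2) n = z by rewrite -sl -/(regs _) regs_at.
  rewrite size_cat sl /= -addSnnS; apply=> //; first by rewrite size_iota.
  by have := all_iota (z :: l2); rewrite size_cat sl /= -addSnnS => ->; rewrite addSn ltnS leq_addr.
have zu z : while_runs (fun z => cond (z :: l)) (fun z => step (z :: l)) (u l) z (F l) -> z <= u l.
  by case.
have Fu : F l <= u l by elim: (Hw l sl).
split; first exact: leq_ltn_trans uE.
apply: (@ExSeq _ _ _ _ (regs (l ++ [:: init l]))).
  have := @pscmd_push n init ci E (iota 0 n) l L E0 (pscmd_mono (leq_trans aiA AE) Hi).
  have := map_nth_iota_cat l [::]; rewrite cats0 sl cats1 => ->; apply=> //.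
    by rewrite size_iota.
  by have := all_iota [::]; rewrite cats0 sl.
apply: (@ExSeq _ _ _ _ (regs (l ++ [:: init l; cond (init l :: l)]))).
  have [_] := call cond cc ac [::] (init l) (leq_maxl _ _) Hc (zu _ (Hw l sl)).
  by rewrite addn0 rcons_cat.
elim: (Hw l sl) => {Fu} [z zU cz|z z' zU cz hz IH].
  have -> : regs (rcons l z) = regs (l ++ [:: z; cond (z :: l)]).
    by rewrite cz -cat_rcons (regs_cat0 _ 1).
  by apply: ExWhile0; rewrite -sl -(size_rcons l z) -cat_rcons regs_at.
have sU : step (z :: l) <= u l by case: hz.
apply: ExWhileS IH; first by rewrite -sl -(size_rcons l z) -cat_rcons regs_at lt0n.
have [_ ex1] := call step cs as_ [:: cond (z :: l)] z (leq_maxr _ _) Hs zU.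
rewrite addn1 rcons_cat /= in ex1; apply: ExSeq ex1 _.
have [sB _] := call step cs as_ [::] z (leq_maxr _ _) Hs zU.
apply: (@ExSeq _ _ _ _ (regs (l ++ [:: step (z :: l); cond (z :: l)]))).
  have := @exec_set_reg (pbound E L) l z [:: cond (z :: l)] (step (z :: l)) (ltnW sB).
  by rewrite sl addn2.
have [cB ex2] := call cond cc ac [:: cond (z :: l)] (step (z :: l)) (leq_maxl _ _) Hc sU.
rewrite addn1 rcons_cat /= in ex2; apply: ExSeq ex2 _.
have := @exec_set_reg (pbound E L) (l ++ [:: step (z :: l)]) (cond (z :: l)) [::] _ (ltnW cB).
by rewrite -!catA /= size_cat sl addn1 addn1.
Qed.

(** * Arithmetic and bounded search *)

Lemma psfun_fun1 (F : nat -> nat) : psfun 1 (fun l => F (nth 0 l 0)) ->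
  forall n g, psfun n g -> psfun n (fun l => F (g l)).
Proof.
by move=> HF n g Hg; apply: (@psfun_comp n _ [:: g] HF); case.
Qed.

(** Such lemmas reduce a closure property to the case where the arguments are plain variables, in
    which the recursion scheme applies. *)
Lemma psfun_fun2 (F : nat -> nat -> nat) : psfun 2 (fun l => F (nth 0 l 0) (nth 0 l 1)) ->
  forall n g1 g2, psfun n g1 -> psfun n g2 -> psfun n (fun l => F (g1 l) (g2 l)).
Proof.
by move=> HF n g1 g2 H1 H2; apply: (@psfun_comp n _ [:: g1; g2] HF); do 2?case=> //.
Qed.

Lemma psfun_fun4 (F : nat -> nat -> nat -> nat -> nat) :
  psfun 4 (fun l => F (nth 0 l 0) (nth 0 l 1) (nth 0 l 2) (nth 0 l 3)) ->
  forall n g1 g2 g3 g4, psfun n g1 -> psfun n g2 -> psfun n g3 -> psfun n g4 ->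
  psfun n (fun l => F (g1 l) (g2 l) (g3 l) (g4 l)).
Proof.
move=> HF n g1 g2 g3 g4 H1 H2 H3 H4.
by apply: (@psfun_comp n _ [:: g1; g2; g3; g4] HF); do 4?case=> //.
Qed.

Lemma psfun_succ n g : psfun n g -> psfun n (fun l => (g l).+1).
Proof. exact: psfun_fun1 psfun_succ_var n g. Qed.

Lemma psfun_const n m : psfun n (fun=> m).
Proof. by elim: m => [|m IH]; [apply: psfun_zero | apply: psfun_succ]. Qed.

(* The closure lemmas take arbitrary argument functions, so membership in [psfun] is found by
   following the syntax of the body. *)
Create HintDb psf.
#[local] Hint Resolve psfun_succ psfun_const : psf.
#[local] Hint Extern 1 (psfun _ (fun l => nth 0 l _)) => apply: psfun_nth; done : psf.

Ltac psf := auto 100 with psf.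

Lemma psfun_add n f g : psfun n f -> psfun n g -> psfun n (fun l => f l + g l).
Proof.
apply: psfun_fun2.
have it x i : iteri i (fun=> S) x = x + i by elim: i => [|i /= ->] /=; lia.
apply: psfun_ext (_ : psfun 2 (fun l => iteri (nth 0 l 1) (fun _ acc => acc.+1) (nth 0 l 0))) _; last first.
  by move=> l _; rewrite it.
apply: (@psfun_rec 2 _ _ (fun l => (nth 0 l 1).+1) (fun l => nth 0 l 0 + nth 0 l 1)); psf.
  exists 1 => L [|x [|y []]] // _ /and3P[xL yL _] /=.
  apply: (@leq_trans (2 ^ L.+1)); first by rewrite expnS; lia.
  by rewrite /pbound leq_pexp2l // expn1; lia.
by move=> l i _ il; rewrite it leq_add2l.
Qed.
#[local] Hint Resolve psfun_add : psf.

Lemma psfun_mul n f g : psfun n f -> psfun n g -> psfun n (fun l => f l * g l).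
Proof.
apply: psfun_fun2.
have it x i : iteri i (fun _ acc => acc + x) 0 = x * i by elim: i => [|i /= ->] /=; lia.
apply: psfun_ext (_ : psfun 2 (fun l => iteri (nth 0 l 1) (fun _ acc => acc + nth 0 l 0) 0)) _; last first.
  by move=> l _; rewrite it.
apply: (@psfun_rec 2 _ _ (fun l => nth 0 l 1 + nth 0 l 2) (fun l => nth 0 l 0 * nth 0 l 1)); psf.
  exists 2 => L [|x [|y []]] // _ /and3P[xL yL _] /=.
  apply: (@leq_trans (2 ^ (L + L))); last by rewrite /pbound leq_pexp2l //; nia.
  by rewrite expnD ltn_mul.
by move=> l i _ il; rewrite it leq_mul2l il orbT.
Qed.
#[local] Hint Resolve psfun_mul : psf.

Lemma psfun_pred n f : psfun n f -> psfun n (fun l => (f l).-1).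
Proof.
apply: (psfun_fun1 (F := predn)).
(* The index of the last round is the predecessor of the number of rounds. *)
apply: psfun_ext (_ : psfun 1 (fun l => iteri (nth 0 l 0) (fun j _ => j) 0)) _; last first.
  by move=> l _; case: (nth 0 l 0).
apply: (@psfun_rec 1 _ _ (fun l => nth 0 l 0) (fun l => nth 0 l 0)); psf.
  by apply: psfun_bounded; psf.
by move=> l [//|i] _ /= /ltnW.
Qed.
#[local] Hint Resolve psfun_pred : psf.

Lemma psfun_sub n f g : psfun n f -> psfun n g -> psfun n (fun l => f l - g l).
Proof.
apply: psfun_fun2.
have it x i : iteri i (fun=> predn) x = x - i by elim: i => [|i /= ->] /=; lia.
apply: psfun_ext (_ : psfun 2 (fun l => iteri (nth 0 l 1) (fun _ acc => acc.-1) (nth 0 l 0))) _; last first.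
  by move=> l _; rewrite it.
apply: (@psfun_rec 2 _ _ (fun l => (nth 0 l 1).-1) (fun l => nth 0 l 0)); psf.
  by apply: psfun_bounded; psf.
by move=> l i _ il; rewrite it leq_subr.
Qed.
#[local] Hint Resolve psfun_sub : psf.

Lemma psfun_eq0 n f : psfun n f -> psfun n (fun l => nat_of_bool (f l == 0)).
Proof.
apply: (psfun_fun1 (F := fun x => nat_of_bool (x == 0))).
apply: psfun_ext (_ : psfun 1 (fun l => 1 - nth 0 l 0)) _; psf.
by move=> l _; case: (nth 0 l 0).
Qed.

Lemma psfun_leq n f g : psfun n f -> psfun n g -> psfun n (fun l => nat_of_bool (f l <= g l)).
Proof. by move=> Hf Hg; rewrite /leq; apply: psfun_eq0; psf. Qed.
#[local] Hint Resolve psfun_leq : psf.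

Lemma psfun_and n (b c : seq nat -> bool) : psfun n (fun l => nat_of_bool (b l)) ->
  psfun n (fun l => nat_of_bool (c l)) -> psfun n (fun l => nat_of_bool (b l && c l)).
Proof.
move=> Hb Hc; apply: psfun_ext (psfun_mul Hb Hc) _ => l _.
by case: (b l); case: (c l).
Qed.

Lemma psfun_not n (b : seq nat -> bool) : psfun n (fun l => nat_of_bool (b l)) ->
  psfun n (fun l => nat_of_bool (~~ b l)).
Proof. by move=> Hb; apply: psfun_ext (psfun_eq0 Hb) _ => l _; case: (b l). Qed.
#[local] Hint Resolve psfun_and psfun_not : psf.

Lemma psfun_or n (b c : seq nat -> bool) : psfun n (fun l => nat_of_bool (b l)) ->
  psfun n (fun l => nat_of_bool (c l)) -> psfun n (fun l => nat_of_bool (b l || c l)).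
Proof.
move=> Hb Hc; apply: psfun_ext (psfun_not (psfun_and (psfun_not Hb) (psfun_not Hc))) _ => l _.
by rewrite negb_and !negbK.
Qed.

Lemma psfun_eq n f g : psfun n f -> psfun n g -> psfun n (fun l => nat_of_bool (f l == g l)).
Proof.
move=> Hf Hg; apply: psfun_ext (psfun_and (psfun_leq Hf Hg) (psfun_leq Hg Hf)) _ => l _.
by rewrite eqn_leq.
Qed.
#[local] Hint Resolve psfun_or psfun_eq : psf.

Lemma psfun_if n (b : seq nat -> bool) f g : psfun n (fun l => nat_of_bool (b l)) ->
  psfun n f -> psfun n g -> psfun n (fun l => if b l then f l else g l).
Proof.
move=> Hb Hf Hg.
apply: psfun_ext (_ : psfun n (fun l => b l * f l + ~~ b l * g l)) _; first by psf.
by move=> l _; case: (b l); lia.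
Qed.
#[local] Hint Resolve psfun_if : psf.

Lemma psfun_div n f g : psfun n f -> psfun n g -> psfun n (fun l => f l %/ g l).
Proof.
apply: psfun_fun2.
(* The quotient candidate grows as long as its successor times the divisor fits; as many rounds as
   the dividend suffice. *)
pose h l := if (nth 0 l 1).+1 * nth 0 l 3 <= nth 0 l 2 then (nth 0 l 1).+1 else nth 0 l 1.
have it l i : 0 < nth 0 l 1 ->
    iteri i (fun j acc => h [:: j, acc & l]) 0 = minn i (nth 0 l 0 %/ nth 0 l 1).
  move=> l1; elim: i => [|i /= ->]; first by rewrite min0n.
  by rewrite /h /= -leq_divRL //; case: leqP; lia.
apply: psfun_ext (_ : psfun 2 (fun l => if nth 0 l 1 == 0 then 0 else
   iteri (nth 0 l 0) (fun j acc => h [:: j, acc & l]) 0)) _; last first.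
  move=> l _; case: eqP => [->|]; first by rewrite divn0.
  by move/eqP; rewrite -lt0n => l1; rewrite it //; apply/minn_idPr; apply: leq_div.
apply: psfun_if; psf.
apply: (@psfun_rec 2 _ _ h (fun l => nth 0 l 0)); rewrite /h; psf.
  by apply: psfun_bounded; psf.
move=> l i _ il; apply: leq_trans il.
elim: i => [//|i /= IH]; case: ifP => _ //; exact: leqW.
Qed.
#[local] Hint Resolve psfun_div : psf.

Lemma psfun_mod n f g : psfun n f -> psfun n g -> psfun n (fun l => f l %% g l).
Proof.
move=> Hf Hg; apply: psfun_ext (_ : psfun n (fun l => f l - f l %/ g l * g l)) _; first by psf.
by move=> l _; rewrite {1}(divn_eq (f l) (g l)) addKn.
Qed.
#[local] Hint Resolve psfun_mod : psf.

Lemma psfun_odd n f : psfun n f -> psfun n (fun l => nat_of_bool (odd (f l))).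
Proof.
by move=> Hf; apply: psfun_ext (_ : psfun n (fun l => f l %% 2)) _ => [|l _]; rewrite ?modn2; psf.
Qed.

Lemma psfun_has n m (p : seq nat -> bool) : psfun n m ->
  psfun n.+1 (fun l => nat_of_bool (p l)) ->
  psfun n (fun l => nat_of_bool (has (fun i => p (i :: l)) (iota 0 (m l)))).
Proof.
move=> Hm Hp.
have it l i : iteri i (fun j (acc : nat) => nat_of_bool ((0 < acc) || p (j :: l))) 0 =
    has (fun i => p (i :: l)) (iota 0 i).
  elim: i => [//|i IH]; rewrite -[in RHS]addn1 iotaD has_cat [LHS]/= IH /= add0n orbF.
  by case: (has _ _).
apply: psfun_ext (_ : psfun n (fun l => iteri (m l) (fun j acc =>
   nat_of_bool ((0 < acc) || p (j :: l))) 0)) _; last by move=> l _; rewrite it.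
apply: (@psfun_rec n m _ (fun l => nat_of_bool ((0 < nth 0 l 1) || p (nth 0 l 0 :: behead (behead l))))
   (fun=> 1)); psf.
- apply: psfun_or; first by psf.
  (* The round sees index, accumulator and arguments, while [p] expects no accumulator; composing
     with projections drops it. *)
  have := @psfun_comp n.+2 (fun l => nat_of_bool (p l))
    ((fun l => nth 0 l 0) :: [seq (fun l => nth 0 l i.+2) | i <- iota 0 n]).
  rewrite /= size_map size_iota => H.
  apply: psfun_ext (H Hp _) _; last first.
    move=> [|x [|y l]] // [sl] /=; rewrite -map_comp /comp /=.
    have -> // : [seq nth 0 l i | i <- iota 0 n] = l.
    by have := map_nth_iota_cat l [::]; rewrite cats0 sl.
  case=> [_|i ip] /=; first by psf.
  by rewrite (nth_map 0) ?size_iota // nth_iota //; psf.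
- by apply: psfun_bounded; psf.
- by move=> l i _ _; case: i => [//|i] /=; case: (_ || _).
Qed.
#[local] Hint Resolve psfun_odd : psf.

(** * Decoding the input *)

(** A digit is a pair of bits starting with 1, hence the division by 4. At the terminator the
    function is stationary, so iterating it too often does no harm. *)
Definition next_digit (r : nat) : nat := if odd r then r %/ 4 else r.

Definition digits_from (i n : nat) : nat := iteri i (fun=> next_digit) n.

Lemma digits_fromS i n : digits_from i.+1 n = next_digit (digits_from i n).
Proof. by []. Qed.

Definition rd_rest (n : nat) : nat := digits_from n n %/ 4.

(** Digits arrive least significant first while Horner's scheme starts from the top, so positions
    are visited downwards. Those beyond the last digit show the terminator and keep the accumulator
    at 0. The code itself is ample fuel, by [size_digits_le_code]. *)
Definition rd_val (n : nat) : nat :=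
  iteri n (fun j acc => if odd (digits_from (n.-1 - j) n)
                        then acc * 2 + (digits_from (n.-1 - j) n %/ 2) %% 2 else 0) 0.

Fixpoint rd_digits (f r : nat) : nat :=
  if f is f'.+1 then if odd r then rd_digits f' (r %/ 4) * 2 + (r %/ 2) %% 2 else 0 else 0.

Lemma rd_digitsS f r : rd_digits f.+1 r =
  if odd r then rd_digits f (r %/ 4) * 2 + (r %/ 2) %% 2 else 0.
Proof. by []. Qed.

Lemma digits_from_le i n : digits_from i n <= n.
Proof.
elim: i => [//|i IH] /=; apply: leq_trans IH.
by rewrite /next_digit; case: ifP => // _; apply: leq_div.
Qed.

Lemma rd_digits_le f r : rd_digits f r <= r.
Proof.
elim: f r => [//|f IH] r /=; case: ifP => // rodd.
by have := IH (r %/ 4); lia.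
Qed.

Lemma rd_valE n j : j <= n ->
  iteri j (fun j acc => if odd (digits_from (n.-1 - j) n)
                        then acc * 2 + (digits_from (n.-1 - j) n %/ 2) %% 2 else 0) 0 =
  rd_digits j (digits_from (n - j) n).
Proof.
elim: j => [//|j IH] jn; rewrite [LHS]/= IH ?(ltnW jn) //=.
have -> : n - j.+1 = n.-1 - j by lia.
have -> : n - j = (n.-1 - j).+1 by lia.
case: ifP => // od.
by rewrite digits_fromS /next_digit od.
Qed.

Lemma psfun_next_digit n g : psfun n g -> psfun n (fun l => next_digit (g l)).
Proof. by move=> Hg; rewrite /next_digit; psf. Qed.
#[local] Hint Resolve psfun_next_digit : psf.

Lemma psfun_digits_from n f g : psfun n f -> psfun n g -> psfun n (fun l => digits_from (f l) (g l)).
Proof.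
apply: psfun_fun2.
apply: (@psfun_rec 2 _ _ (fun l => next_digit (nth 0 l 1)) (fun l => nth 0 l 1)); psf.
  by apply: psfun_bounded; psf.
by move=> l i _ _; apply: digits_from_le.
Qed.
#[local] Hint Resolve psfun_digits_from : psf.

Lemma psfun_rd_rest n g : psfun n g -> psfun n (fun l => rd_rest (g l)).
Proof. by move=> Hg; rewrite /rd_rest; psf. Qed.

Lemma psfun_rd_val n g : psfun n g -> psfun n (fun l => rd_val (g l)).
Proof.
apply: psfun_fun1.
apply: (@psfun_rec 1 _ _ (fun l => if odd (digits_from ((nth 0 l 2).-1 - nth 0 l 0) (nth 0 l 2))
   then nth 0 l 1 * 2 + (digits_from ((nth 0 l 2).-1 - nth 0 l 0) (nth 0 l 2) %/ 2) %% 2 else 0)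
   (fun l => nth 0 l 0)); psf.
  by apply: psfun_bounded; psf.
move=> l i _ il; apply: leq_trans (digits_from_le (nth 0 l 0 - i) (nth 0 l 0)).
by rewrite (rd_valE il) rd_digits_le.
Qed.
#[local] Hint Resolve psfun_rd_rest psfun_rd_val : psf.

Lemma rd_rest_le n : rd_rest n <= n.
Proof. by apply: leq_trans (leq_div _ _) (digits_from_le _ _). Qed.

Definition val_bits (D : seq bool) : nat := foldr (fun (b : bool) acc => b + acc * 2) 0 D.

Lemma val_bits_bits n : val_bits (bits n) = n.
Proof.
rewrite /bits; suff gen f m : m <= f -> val_bits (bin_aux f m) = m by apply: gen.
elim: f m => [|f IH] m mf /=; first by lia.
case: eqP => [->//|m0] /=; rewrite IH; last by lia.
lia.
Qed.

Lemma val_bits_lt D : val_bits D < 2 ^ size D.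
Proof. by elim: D => [//|b D IH] /=; rewrite expnS; case: b => /=; lia. Qed.

Lemma code_digits (b : bool) tl : let r := code_bits [:: true, b & tl] in
  [/\ odd r, r %/ 4 = code_bits tl & (r %/ 2) %% 2 = b].
Proof. by rewrite /=; case: b => /=; split; lia. Qed.

Lemma code_end tl : let r := code_bits [:: false, false & tl] in
  odd r = false /\ r %/ 4 = code_bits tl.
Proof. by rewrite /=; split; lia. Qed.

Section ReadDigits.
Variables (D bs : seq bool).
Let x := flatten [seq [:: true; b] | b <- D] ++ [:: false, false & bs].

Lemma rd_digits_code f : size D <= f -> rd_digits f (code_bits x) = val_bits D.
Proof.
rewrite {}/x; elim: D f => [|b D' IH] [|f] // Df.
  by rewrite rd_digitsS; have [-> _] := code_end bs.
rewrite -[code_bits _]/(code_bits [:: true, b & flatten [seq [:: true; b] | b <- D'] ++ [:: false, false & bs]]).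
have [od dv md] := code_digits b (flatten [seq [:: true; b] | b <- D'] ++ [:: false, false & bs]).
by rewrite rd_digitsS od dv md IH // addnC.
Qed.

Lemma digits_from_code f : size D <= f -> digits_from f (code_bits x) = code_bits [:: false, false & bs].
Proof.
have shiftE i n : digits_from i.+1 n = digits_from i (next_digit n).
  by elim: i => [//|i IH]; rewrite [LHS](digits_fromS i.+1) IH.
rewrite {}/x; elim: D f => [|b D' IH] f Df.
  elim: f Df => [//|f IH'] _; rewrite digits_fromS IH' //.
  by have [od _] := code_end bs; rewrite /next_digit od.
case: f Df => [//|f] Df; rewrite shiftE.
rewrite -[code_bits (flatten _ ++ _)]/(code_bits [:: true, b & flatten [seq [:: true; b] | b <- D'] ++ [:: false, false & bs]]).
have [od dv _] := code_digits b (flatten [seq [:: true; b] | b <- D'] ++ [:: false, false & bs]).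
by rewrite {1}/next_digit od dv IH.
Qed.

Lemma size_digits_le_code : size D <= code_bits x.
Proof.
apply: leq_trans (code_bits_ge _); apply: ltnW.
apply: leq_ltn_trans (ltn_expl _ (ltnSn 1)).
rewrite /x size_cat; elim: (D) => [//|b D' IH]; move: IH => /=; lia.
Qed.

End ReadDigits.

Lemma enc_natE n bs : enc_nat n ++ bs = flatten [seq [:: true; b] | b <- bits n] ++ [:: false, false & bs].
Proof. by rewrite /enc_nat -catA. Qed.

Lemma rd_val_enc n bs : rd_val (code_bits (enc_nat n ++ bs)) = n.
Proof.
rewrite /rd_val rd_valE // subnn enc_natE rd_digits_code ?val_bits_bits //.
exact: size_digits_le_code.
Qed.

Lemma rd_rest_enc n bs : rd_rest (code_bits (enc_nat n ++ bs)) = code_bits bs.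
Proof.
rewrite /rd_rest enc_natE digits_from_code; last exact: size_digits_le_code.
by have [] := code_end bs.
Qed.

Lemma enc_nat_lt n : n < 2 ^ size (enc_nat n).
Proof.
rewrite -{1}(val_bits_bits n); apply: leq_trans (val_bits_lt _) _.
rewrite leq_pexp2l // size_cat; elim: (bits n) => [//|b D IH]; move: IH => /=; lia.
Qed.

Definition rd_int_rest (n : nat) : nat := rd_rest (n %/ 2).
(** Registers hold natural numbers only, so an integer is read as a difference of two; the successor
    in the negative part comes from [Negz]. *)
Definition rd_int_pos (n : nat) : nat := if odd n then 0 else rd_val (n %/ 2).
Definition rd_int_neg (n : nat) : nat := if odd n then (rd_val (n %/ 2)).+1 else 0.

Lemma psfun_rd_int_rest n g : psfun n g -> psfun n (fun l => rd_int_rest (g l)).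
Proof. by move=> Hg; rewrite /rd_int_rest; psf. Qed.

Lemma psfun_rd_int_pos n g : psfun n g -> psfun n (fun l => rd_int_pos (g l)).
Proof. by move=> Hg; rewrite /rd_int_pos; psf. Qed.

Lemma psfun_rd_int_neg n g : psfun n g -> psfun n (fun l => rd_int_neg (g l)).
Proof. by move=> Hg; rewrite /rd_int_neg; psf. Qed.
#[local] Hint Resolve psfun_rd_int_rest psfun_rd_int_pos psfun_rd_int_neg : psf.

Lemma rd_int_rest_le n : rd_int_rest n <= n.
Proof. by apply: leq_trans (rd_rest_le _) (leq_div _ _). Qed.

Lemma code_bits_cons (b : bool) bs : odd (code_bits (b :: bs)) = b /\ code_bits (b :: bs) %/ 2 = code_bits bs.
Proof. by rewrite /=; case: b => /=; split; lia. Qed.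

Lemma rd_int_rest_enc z bs : rd_int_rest (code_bits (enc_int z ++ bs)) = code_bits bs.
Proof.
case: z => n; rewrite /rd_int_rest [enc_int _ ++ _]/=.
  by have [_ ->] := code_bits_cons false (enc_nat n ++ bs); rewrite rd_rest_enc.
by have [_ ->] := code_bits_cons true (enc_nat n ++ bs); rewrite rd_rest_enc.
Qed.

Lemma rd_int_enc z bs : let r := code_bits (enc_int z ++ bs) in
  ((rd_int_pos r)%:R - (rd_int_neg r)%:R = z%:~R :> rat)%R.
Proof.
case: z => n r; rewrite /rd_int_pos /rd_int_neg {}/r [enc_int _ ++ _]/=.
  have [-> ->] := code_bits_cons false (enc_nat n ++ bs).
  by rewrite rd_val_enc GRing.subr0.
have [-> ->] := code_bits_cons true (enc_nat n ++ bs).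
by rewrite rd_val_enc GRing.sub0r.
Qed.

Lemma rd_int_pos_enc n bs : rd_int_pos (code_bits (enc_int (Posz n) ++ bs)) = n.
Proof.
rewrite /rd_int_pos [enc_int _ ++ _]/=.
by have [-> ->] := code_bits_cons false (enc_nat n ++ bs); rewrite rd_val_enc.
Qed.

(** * Savitch's recursion *)

Section Savitch.
Variables (E : nat -> nat -> bool) (V : nat).

Fixpoint reach_in (d u v : nat) : bool :=
  if d is d'.+1 then has (fun w => reach_in d' u w && reach_in d' w v) (iota 0 V)
  else E u v || (u == v).

(** One digit must hold a node, a mode up to 2, or a path length; lengths are powers of two up to
    2V. *)
Definition sv_base : nat := V * 2 + 3.
Let B := sv_base.

(** The stack is a number in base B with its top as the lowest digit. Frames carry a nonzero tag on
    top, so a stack of frames is empty exactly when the number is 0. *)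
Definition sv_push (x s : nat) : nat := x + B * s.
Definition sv_state (m len u v S : nat) : nat :=
  sv_push m (sv_push len (sv_push u (sv_push v S))).

(* Mode 2 asks for a path of length at most [len] from [u] to [v], modes 0 and 1 are
   the answers.  A pending call with midpoint [w] leaves on the stack either
   [1; v] while the half from [u] to [w] is examined, or [2; u] while the half from [w]
   to [v] is. *)
Definition sv_next (m len u v S : nat) : nat :=
  let S' := S %/ B %/ B in
  let o := (S %/ B) %% B in
  let fail a b w := if w.+1 < V then sv_state 2 len a w.+1 (sv_push 1 (sv_push b S'))
                    else sv_state 0 (len * 2) a b S' in
  if m == 2 then
    if len == 1 then sv_state (nat_of_bool (E u v || (u == v))) 1 u v S
    else sv_state 2 (len %/ 2) u 0 (sv_push 1 (sv_push v S))
  else if S %% B == 1 then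
    if m == 1 then sv_state 2 len v o (sv_push 2 (sv_push u S')) else fail u o v
  else if m == 1 then sv_state 1 (len * 2) o v S' else fail o v u.

Definition sv_step (Z : nat) : nat :=
  sv_next (Z %% B) (Z %/ B %% B) (Z %/ B %/ B %% B) (Z %/ B %/ B %/ B %% B)
    (Z %/ B %/ B %/ B %/ B).

Definition sv_running (Z : nat) : bool := (Z %% B == 2) || (Z %/ B %/ B %/ B %/ B != 0).

Let B0 : 0 < B. Proof. by rewrite /B /sv_base addn3. Qed.

Lemma sv_push_mod x s : x < B -> sv_push x s %% B = x.
Proof. by move=> xB; rewrite /sv_push mulnC addnC modnMDl modn_small. Qed.

Lemma sv_push_div x s : x < B -> sv_push x s %/ B = s.
Proof. by move=> xB; rewrite /sv_push mulnC addnC divnMDl // divn_small // addn0. Qed.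

Lemma sv_stepE m len u v S : m < B -> len < B -> u < B -> v < B ->
  sv_step (sv_state m len u v S) = sv_next m len u v S.
Proof. by move=> *; rewrite /sv_step /sv_state !(sv_push_div, sv_push_mod). Qed.

Lemma sv_runningE m len u v S : m < B -> len < B -> u < B -> v < B ->
  sv_running (sv_state m len u v S) = (m == 2) || (S != 0).
Proof. by move=> *; rewrite /sv_running /sv_state !(sv_push_div, sv_push_mod). Qed.

Lemma sv_push_lt x s j : x < B -> s < B ^ j -> sv_push x s < B ^ j.+1.
Proof. by rewrite /sv_push expnS => xB sj; nia. Qed.

Lemma sv_state_le m len u v S j J : m < B -> len < B -> u < B -> v < B -> S < B ^ j -> j + 4 <= J ->
  sv_state m len u v S <= B ^ J.
Proof.
move=> *; apply: ltnW; apply: (@leq_trans (B ^ (j + 4))); last by rewrite leq_pexp2l.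
by rewrite addn4; do 4!apply: sv_push_lt => //.
Qed.

Variable d0 : nat.
Hypothesis d0V : 2 ^ d0 <= V * 2.
Let U := B ^ (d0 * 2 + 4).
Let runs := while_runs (fun Z => nat_of_bool (sv_running Z)) sv_step U.

(** Stated with a continuation: whatever the machine does after the answer, it does after the call.
    Nested calls then chain by applying the induction hypothesis to the rest of the run. Each open
    level costs two stack digits, and the four digits of the state complete the exponent in [U]. The
    midpoint is never stacked, being an endpoint of the half under examination. *)
Lemma sv_call d u v S Zf : d <= d0 -> u < V -> v < V -> S < B ^ ((d0 - d) * 2) ->
  runs (sv_state (reach_in d u v) (2 ^ d) u v S) Zf -> runs (sv_state 2 (2 ^ d) u v S) Zf.
Proof.
have small_lt x : x <= V * 2 -> x < B by rewrite /B /sv_base; lia.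
have [lt2 lt1 lt0] : [/\ 2 < B, 1 < B & 0 < B] by rewrite /B /sv_base; split; lia.
have lev d' : d' <= d0 -> 2 ^ d' < B.
  by move=> le; apply/small_lt/(leq_trans _ d0V); rewrite leq_pexp2l.
have lebool (b : bool) : b < B by case: b.
elim: d u v S Zf => [|d IH] u v S Zf dd uV vV SB.
  have [uB vB] : u < B /\ v < B by split; apply: small_lt; lia.
  move=> H; apply: WhStep; rewrite ?sv_runningE ?sv_stepE ?eqxx //.
    by apply: sv_state_le SB _ => //; lia.
have [uB vB] : u < B /\ v < B by split; apply: small_lt; lia.
have dd' := ltnW dd.
have push2 x y : x < B -> y < B -> sv_push x (sv_push y S) < B ^ ((d0 - d) * 2).
  move=> xB yB; have -> : (d0 - d) * 2 = ((d0 - d.+1) * 2).+2 by lia.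
  by do 2!apply: sv_push_lt => //.
have len2 : 2 ^ d * 2 = 2 ^ d.+1 by rewrite expnS mulnC.
have fold x y S' : x < B -> y < B -> [/\ sv_push x (sv_push y S') %% B = x,
    sv_push x (sv_push y S') %/ B %/ B = S' & sv_push x (sv_push y S') %/ B %% B = y].
  by move=> xB yB; rewrite !sv_push_div // !sv_push_mod.
have push_neq0 x y S' : 0 < x -> sv_push x (sv_push y S') != 0 by rewrite /sv_push; lia.
(* Induction on the number of midpoints still to be tried, starting from w. *)
have loop k w : w + k.+1 = V ->
   runs (sv_state (has (fun w => reach_in d u w && reach_in d w v) (iota w k.+1)) (2 ^ d.+1) u v S) Zf ->
   runs (sv_state 2 (2 ^ d) u w (sv_push 1 (sv_push v S))) Zf.
  elim: k w => [|k IHk] w wk H.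
    have wV : w < V by lia.
    have wB : w < B by apply: small_lt; lia.
    have noV : w.+1 < V = false by lia.
    apply: (IH) => //; first exact: push2.
    have [f1 f2 f3] := fold 1 v S lt1 vB.
    apply: WhStep; rewrite ?sv_runningE ?sv_stepE ?push_neq0 ?orbT ?lev //.
      by apply: sv_state_le (push2 _ _ lt1 vB) _ => //; rewrite ?lev //; lia.
    rewrite /sv_next f1 f2 f3 eqxx noV len2.
    case R1: (reach_in d u w) H => /= H; last by rewrite R1 /= in H *.
    apply: (IH) => //; first exact: push2.
    have [g1 g2 g3] := fold 2 u S lt2 uB.
    apply: WhStep; rewrite ?sv_runningE ?sv_stepE ?push_neq0 ?orbT ?lev //.
      by apply: sv_state_le (push2 _ _ lt2 uB) _ => //; rewrite ?lev //; lia.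
    rewrite /sv_next g1 g2 g3 noV len2.
    by move: H; rewrite R1 orbF; case: (reach_in d w v).
  have wV : w < V by lia.
  have wB : w < B by apply: small_lt; lia.
  have yesV : w.+1 < V by lia.
  apply: (IH) => //; first exact: push2.
  have [f1 f2 f3] := fold 1 v S lt1 vB.
  apply: WhStep; rewrite ?sv_runningE ?sv_stepE ?push_neq0 ?orbT ?lev //.
    by apply: sv_state_le (push2 _ _ lt1 vB) _ => //; rewrite ?lev //; lia.
  rewrite /sv_next f1 f2 f3 eqxx yesV.
  have Hnext : reach_in d u w && reach_in d w v = false ->
      runs (sv_state 2 (2 ^ d) u w.+1 (sv_push 1 (sv_push v S))) Zf.
    by move=> R; apply: IHk; [lia | move: H; rewrite [has _ _]/= R].
  case R1: (reach_in d u w) => /=; last by apply: Hnext; rewrite R1.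
  apply: (IH) => //; first exact: push2.
  have [g1 g2 g3] := fold 2 u S lt2 uB.
  apply: WhStep; rewrite ?sv_runningE ?sv_stepE ?push_neq0 ?orbT ?lev //.
    by apply: sv_state_le (push2 _ _ lt2 uB) _ => //; rewrite ?lev //; lia.
  rewrite /sv_next g1 g2 g3 yesV len2.
  case R2: (reach_in d w v) => /=; last by apply: Hnext; rewrite R1 R2.
  by move: H; rewrite [has _ _]/= R1 R2.
move=> H; apply: WhStep; rewrite ?sv_runningE ?sv_stepE ?eqxx ?lev //.
  by apply: sv_state_le SB _ => //; rewrite ?lev //; lia.
rewrite /sv_next eqxx; have -> : (2 ^ d.+1 == 1) = false by rewrite expnS; lia.
have -> : 2 ^ d.+1 %/ 2 = 2 ^ d by rewrite expnS mulKn.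
by apply: (loop V.-1); rewrite ?prednK //; lia.
Qed.

Lemma sv_runs u v : u < V -> v < V ->
  runs (sv_state 2 (2 ^ d0) u v 0) (sv_state (reach_in d0 u v) (2 ^ d0) u v 0).
Proof.
have small_lt x : x <= V * 2 -> x < B by rewrite /B /sv_base; lia.
move=> uV vV; have [uB vB] : u < B /\ v < B by split; apply: small_lt; lia.
have lB := small_lt _ d0V.
have bB (b : bool) : b < B by case: b; rewrite /B /sv_base; lia.
apply: sv_call => //; first by rewrite subnn.
apply: WhStop; first by apply: (@sv_state_le _ _ _ _ _ 0) => //; lia.
by rewrite sv_runningE //; case: (reach_in _ _ _).
Qed.

End Savitch.

Lemma reach_in_path E V d u v : reach_in E V d u v ->
  exists2 p, path E u p & last u p = v.
Proof.
elim: d u v => [|d IH] u v /=.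
  by case/orP => [e|/eqP <-]; [exists [:: v]; rewrite //= e | exists [::]].
case/hasP => w _ /andP[/IH[p pp <-] /IH[q qq <-]].
by exists (p ++ q); rewrite ?cat_path ?pp ?last_cat.
Qed.

Lemma path_reach_in_le E V d u p : u < V -> all (fun w => w < V) p -> path E u p ->
  size p <= 2 ^ d -> reach_in E V d u (last u p).
Proof.
elim: d u p => [|d IH] u p uV pV pp sp.
  by case: p pp sp {pV} => [|w []] //= ; rewrite ?eqxx ?orbT // andbT => ->.
have := pp; have := pV; rewrite -{1 2}(cat_take_drop (2 ^ d) p) all_cat cat_path.
move=> /andP[pV1 pV2] /andP[pp1 pp2] /=.
have wV : last u (take (2 ^ d) p) < V.
  by have := mem_last u (take (2 ^ d) p); rewrite inE => /orP[/eqP->//|/(allP pV1)].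
apply/hasP; exists (last u (take (2 ^ d) p)); first by rewrite mem_iota.
rewrite IH //; last by rewrite size_take; case: ltnP.
rewrite -{2}(cat_take_drop (2 ^ d) p) last_cat IH // size_drop.
by move: sp; rewrite expnS; lia.
Qed.

Lemma path_reach_in E V d u p : V <= 2 ^ d -> u < V -> all (fun w => w < V) p -> path E u p ->
  reach_in E V d u (last u p).
Proof.
(* A path without repeated nodes has fewer than V edges, so depth d suffices. *)
move=> Vd uV pV pp; case/shortenP: pp pV => p' pp' up' sub pV.
have pV' : all (fun w => w < V) p' by apply/allP => w /sub /(allP pV).
apply: path_reach_in_le => //; apply: leq_trans Vd; apply: ltnW.
rewrite -[(size p').+1]/(size (u :: p')) -(size_iota 0 V); apply: uniq_leq_size => // w.
by rewrite mem_iota add0n leq0n inE => /orP[/eqP->|/(allP pV')].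
Qed.

Lemma psfun_pow_up_log n g : psfun n g -> psfun n (fun l => 2 ^ up_log 2 (g l)).
Proof.
apply: (psfun_fun1 (F := fun x => 2 ^ up_log 2 x)).
have ltE x i : (2 ^ i < x) = (i < up_log 2 x).
  rewrite !ltnNge; congr (~~ _); apply/idP/idP => [/(up_log_min (ltnSn 1))//|le].
  by apply: leq_trans (up_logP x (ltnSn 1)) _; rewrite leq_exp2l.
have it x i : iteri i (fun _ p => if p < x then p * 2 else p) 1 = 2 ^ minn i (up_log 2 x).
  elim: i => [|i /= ->]; first by rewrite min0n.
  rewrite ltE -expnSr; have [ix|ix] := ltnP i (up_log 2 x).
    by rewrite ix; congr (2 ^ _); lia.
  by rewrite ltnn; congr (2 ^ _); lia.
have ub x : up_log 2 x <= x by apply: up_log_min => //; rewrite ltnW // ltn_expl.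
apply: psfun_ext (_ : psfun 1 (fun l => iteri (nth 0 l 0) (fun _ p =>
   if p < nth 0 l 0 then p * 2 else p) 1)) _; last first.
  by move=> l _; rewrite it (minn_idPr _).
apply: (@psfun_rec 1 _ _ (fun l => if nth 0 l 1 < nth 0 l 2 then nth 0 l 1 * 2 else nth 0 l 1)
  (fun l => nth 0 l 0 * 2 + 1)); psf.
  by apply: psfun_bounded; psf.
move=> l i _ _; elim: i => [|i IH]; first by rewrite /= addn1.
by move: IH => /=; case: ifP; lia.
Qed.
#[local] Hint Resolve psfun_pow_up_log : psf.

Lemma pow_up_log_le x : 0 < x -> 2 ^ up_log 2 x <= x * 2.
Proof.
case: x => [//|[|x]] _; first by rewrite up_log1.
have /andP[lt _] := @up_log_bounds 2 x.+2 isT isT.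
have u0 : 0 < up_log 2 x.+2 by rewrite up_log_gt0.
by rewrite -(prednK u0) expnS mulnC leq_mul2r ltnW.
Qed.

Section Reach.
Variables (edge : nat -> nat -> nat -> nat -> bool) (nodes : nat -> nat).
Hypothesis psfun_edge : forall n g1 g2 g3 g4, psfun n g1 -> psfun n g2 -> psfun n g3 -> psfun n g4 ->
  psfun n (fun l => nat_of_bool (edge (g1 l) (g2 l) (g3 l) (g4 l))).
Hypothesis psfun_nodes : forall n g, psfun n g -> psfun n (fun l => nodes (g l)).
Hypothesis nodes_gt0 : forall N, 0 < nodes N.

(** Reducing the nodes keeps them in range for arbitrary arguments, as membership in [psfun] is
    required for all of them. *)
Definition reach (N D u v : nat) : bool :=
  reach_in (edge N D) (nodes N) (up_log 2 (nodes N)) (u %% nodes N) (v %% nodes N).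

(** The quadratic overhead of Savitch's theorem: with X bounding the digits of the base, the depth
    is at most X and the stack has at most X (2X + 4) digits, which is less than 8 X ^ 2. *)
Lemma psbounded_stack : psbounded 4 (fun l => sv_base (nodes (nth 0 l 0)) ^ (up_log 2 (nodes (nth 0 l 0)) * 2 + 4)).
Proof.
have [a Ha] : psbounded 4 (fun l => sv_base (nodes (nth 0 l 0))).
  by apply: psfun_bounded; rewrite /sv_base; psf.
exists (a * 2 + 3) => L l sl ll; have := Ha L l sl ll.
set V := nodes _; set B := sv_base V; rewrite /pbound; set X := (L + 2) ^ a => BX.
have X0 : 0 < X by rewrite expn_gt0 addn2.
have dX : up_log 2 V <= X.
  apply: up_log_min => //; apply: leq_trans (ltnW BX); rewrite /B /sv_base; lia.
apply: (@leq_ltn_trans ((2 ^ X) ^ (X * 2 + 4))).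
  apply: (@leq_trans (B ^ (X * 2 + 4))); last by rewrite leq_exp2r ?addn4 // ltnW.
  by rewrite leq_pexp2l ?leq_add2r ?leq_mul2r ?dX // /B /sv_base addn3.
rewrite -expnM ltn_exp2l // expnD expnM -/X.
have : 2 ^ 3 <= (L + 2) ^ 3 by rewrite leq_exp2r // addn2.
rewrite -[2 ^ 3]/8 -[X ^ 2]/(X * X); set Y := (L + 2) ^ 3 => Y8; nia.
Qed.

Lemma psfun_reach n g1 g2 g3 g4 : psfun n g1 -> psfun n g2 -> psfun n g3 -> psfun n g4 ->
  psfun n (fun l => nat_of_bool (reach (g1 l) (g2 l) (g3 l) (g4 l))).
Proof.
apply: (psfun_fun4 (F := fun a b c d => nat_of_bool (reach a b c d))).
pose V l := nodes (nth 0 l 0).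
pose F l := sv_state (V l) (reach (nth 0 l 0) (nth 0 l 1) (nth 0 l 2) (nth 0 l 3))
  (2 ^ up_log 2 (V l)) (nth 0 l 2 %% V l) (nth 0 l 3 %% V l) 0.
have HF : psfun 4 F.
  apply: (@psfun_while 4
    (fun l => sv_state (V l) 2 (2 ^ up_log 2 (V l)) (nth 0 l 2 %% V l) (nth 0 l 3 %% V l) 0)
    (fun l => nat_of_bool (sv_running (nodes (nth 0 l 1)) (nth 0 l 0)))
    (fun l => sv_step (edge (nth 0 l 1) (nth 0 l 2)) (nodes (nth 0 l 1)) (nth 0 l 0))
    _ F _ _ _ psbounded_stack).
  - by rewrite /V /sv_state /sv_push /sv_base; psf.
  - by rewrite /sv_running /sv_base; psf.
  - by rewrite /sv_step /sv_next /sv_state /sv_push /sv_base; psf.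
  move=> l _; apply: (@sv_runs (edge (nth 0 l 0) (nth 0 l 1)) (V l) (up_log 2 (V l))
    (pow_up_log_le (nodes_gt0 _)) (nth 0 l 2 %% V l) (nth 0 l 3 %% V l)); by rewrite ltn_pmod // /V nodes_gt0.
(* The mode digit of the final state is the answer. *)
apply: psfun_ext (_ : psfun 4 (fun l => F l %% sv_base (V l))) _.
  by rewrite /V /sv_base; psf.
move=> l _; rewrite /F sv_push_mod //; rewrite /sv_base.
by case: (reach _ _ _ _); lia.
Qed.

End Reach.

(** * The configuration graph *)

Definition skip_nats (k n : nat) : nat := iteri k (fun=> rd_rest) n.
Definition rd_trans_rest (n : nat) : nat :=
  rd_int_rest (rd_int_rest (rd_rest (rd_rest (rd_rest n)))).
Definition skip_trans (k n : nat) : nat := iteri k (fun=> rd_trans_rest) n.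

Definition at_QF (N : nat) : nat := rd_rest (rd_rest (rd_rest N)).
Definition at_trans (N : nat) : nat := skip_nats (rd_val (at_QF N)) (rd_rest (at_QF N)).
Definition at_disc (N : nat) : nat := skip_trans (rd_val (at_trans N)) (rd_rest (at_trans N)).
Definition at_target (N : nat) : nat := rd_int_rest (rd_int_rest (at_disc N)).

(** Exceeds the absolute value of every scaled target, so adding it makes the target nonnegative and
    below twice the radix. It also exceeds every state and the common denominator. *)
Definition radix (N : nat) : nat := (N * N * N).+1.
Definition nodes (N : nat) : nat := radix N * (radix N * 2).

(* A node [u] stands for the automaton state [u %% radix N] together with the
   remaining target [(u %/ radix N - radix N) / D]. *)
Definition edge_at (e N D u v : nat) : bool :=
  let w := rd_rest (rd_rest (rd_rest e)) in
  let b := rd_int_pos (rd_int_rest w) in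
  let p := rd_int_pos (at_disc N) in
  let q := rd_int_pos (rd_int_rest (at_disc N)) in
  let k := radix N in
  [&& rd_val e == u %% k, rd_val (rd_rest (rd_rest e)) == v %% k &
   u %/ k * q * b + rd_int_neg w * q * D + p * k * b ==
   k * q * b + rd_int_pos w * q * D + p * (v %/ k) * b].

Definition edge (N D u v : nat) : bool :=
  has (fun i => edge_at (skip_trans i (rd_rest (at_trans N))) N D u v) (iota 0 (rd_val (at_trans N))).

Definition start_node (N D u : nat) : bool :=
  let r := at_target N in
  let b := rd_int_pos (rd_int_rest r) in
  (rd_val (rd_rest (rd_rest N)) == u %% radix N) &&
  (u %/ radix N * b + rd_int_neg r * D == radix N * b + rd_int_pos r * D).

Definition final_node (N v : nat) : bool :=
  (v %/ radix N == radix N) &&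
  has (fun i => rd_val (skip_nats i (rd_rest (at_QF N))) == v %% radix N) (iota 0 (rd_val (at_QF N))).

(** Searching for D avoids computing a common denominator inside the program. *)
Definition answer (N : nat) : bool :=
  has (fun D => (0 < D) &&
    has (fun u => start_node N D u &&
      has (fun v => final_node N v && reach edge nodes N D u v) (iota 0 (nodes N)))
    (iota 0 (nodes N)))
  (iota 0 (radix N)).

Lemma psfun_skip_nats n f g : psfun n f -> psfun n g -> psfun n (fun l => skip_nats (f l) (g l)).
Proof.
apply: psfun_fun2.
apply: (@psfun_rec 2 _ _ (fun l => rd_rest (nth 0 l 1)) (fun l => nth 0 l 1)); psf.
  by apply: psfun_bounded; psf.
by move=> l i _ _; elim: i => [//|i IH] /=; apply: leq_trans (rd_rest_le _) IH.
Qed.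

Lemma psfun_rd_trans_rest n g : psfun n g -> psfun n (fun l => rd_trans_rest (g l)).
Proof. by move=> Hg; rewrite /rd_trans_rest; psf. Qed.
#[local] Hint Resolve psfun_skip_nats psfun_rd_trans_rest : psf.

Lemma rd_trans_rest_le n : rd_trans_rest n <= n.
Proof. by do ![apply: leq_trans (rd_int_rest_le _) _ | apply: leq_trans (rd_rest_le _) _]. Qed.

Lemma psfun_skip_trans n f g : psfun n f -> psfun n g -> psfun n (fun l => skip_trans (f l) (g l)).
Proof.
apply: psfun_fun2.
apply: (@psfun_rec 2 _ _ (fun l => rd_trans_rest (nth 0 l 1)) (fun l => nth 0 l 1)); psf.
  by apply: psfun_bounded; psf.
by move=> l i _ _; elim: i => [//|i IH] /=; apply: leq_trans (rd_trans_rest_le _) IH.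
Qed.
#[local] Hint Resolve psfun_skip_trans : psf.

Lemma psfun_at_QF n g : psfun n g -> psfun n (fun l => at_QF (g l)).
Proof. by move=> Hg; rewrite /at_QF; psf. Qed.
#[local] Hint Resolve psfun_at_QF : psf.

Lemma psfun_at_trans n g : psfun n g -> psfun n (fun l => at_trans (g l)).
Proof. by move=> Hg; rewrite /at_trans; psf. Qed.
#[local] Hint Resolve psfun_at_trans : psf.

Lemma psfun_at_disc n g : psfun n g -> psfun n (fun l => at_disc (g l)).
Proof. by move=> Hg; rewrite /at_disc; psf. Qed.
#[local] Hint Resolve psfun_at_disc : psf.

Lemma psfun_at_target n g : psfun n g -> psfun n (fun l => at_target (g l)).
Proof. by move=> Hg; rewrite /at_target; psf. Qed.

Lemma psfun_radix n g : psfun n g -> psfun n (fun l => radix (g l)).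
Proof. by move=> Hg; rewrite /radix; psf. Qed.
#[local] Hint Resolve psfun_at_target psfun_radix : psf.

Lemma psfun_nodes n g : psfun n g -> psfun n (fun l => nodes (g l)).
Proof. by move=> Hg; rewrite /nodes; psf. Qed.
#[local] Hint Resolve psfun_nodes : psf.

Lemma psfun_edge n g1 g2 g3 g4 : psfun n g1 -> psfun n g2 -> psfun n g3 -> psfun n g4 ->
  psfun n (fun l => nat_of_bool (edge (g1 l) (g2 l) (g3 l) (g4 l))).
Proof.
apply: (psfun_fun4 (F := fun a b c d => nat_of_bool (edge a b c d))).
apply: (@psfun_has 4 _ (fun l => edge_at (skip_trans (nth 0 l 0) (rd_rest (at_trans (nth 0 l 1))))
   (nth 0 l 1) (nth 0 l 2) (nth 0 l 3) (nth 0 l 4))); first by psf.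
by rewrite /edge_at; psf.
Qed.

Lemma nodes_gt0 N : 0 < nodes N. Proof. by rewrite /nodes /radix. Qed.

Lemma psfun_reach_edge n g1 g2 g3 g4 : psfun n g1 -> psfun n g2 -> psfun n g3 -> psfun n g4 ->
  psfun n (fun l => nat_of_bool (reach edge nodes (g1 l) (g2 l) (g3 l) (g4 l))).
Proof. exact: psfun_reach psfun_edge psfun_nodes nodes_gt0 n g1 g2 g3 g4. Qed.
#[local] Hint Resolve psfun_reach_edge : psf.

Lemma psfun_final_node n f g : psfun n f -> psfun n g ->
  psfun n (fun l => nat_of_bool (final_node (f l) (g l))).
Proof.
apply: (psfun_fun2 (F := fun a b => nat_of_bool (final_node a b))).
apply: psfun_and; first by psf.
apply: (@psfun_has 2 _ (fun l => rd_val (skip_nats (nth 0 l 0) (rd_rest (at_QF (nth 0 l 1)))) ==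
   nth 0 l 2 %% radix (nth 0 l 1))); psf.
Qed.
#[local] Hint Resolve psfun_final_node : psf.

Lemma psfun_answer : psfun 1 (fun l => nat_of_bool (answer (nth 0 l 0))).
Proof.
apply: (@psfun_has 1 _ (fun l => (0 < nth 0 l 0) &&
    has (fun u => start_node (nth 0 l 1) (nth 0 l 0) u &&
      has (fun v => final_node (nth 0 l 1) v && reach edge nodes (nth 0 l 1) (nth 0 l 0) u v)
        (iota 0 (nodes (nth 0 l 1))))
    (iota 0 (nodes (nth 0 l 1))))); first by psf.
apply: psfun_and; first by psf.
apply: (@psfun_has 2 _ (fun l => start_node (nth 0 l 2) (nth 0 l 1) (nth 0 l 0) &&
      has (fun v => final_node (nth 0 l 2) v && reach edge nodes (nth 0 l 2) (nth 0 l 1) (nth 0 l 0) v)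
        (iota 0 (nodes (nth 0 l 2))))); first by psf.
apply: psfun_and; first by rewrite /start_node; psf.
apply: (@psfun_has 3 _ (fun l => final_node (nth 0 l 3) (nth 0 l 0) &&
   reach edge nodes (nth 0 l 3) (nth 0 l 2) (nth 0 l 1) (nth 0 l 0))); psf.
Qed.

Theorem psfun_decider (p : nat -> bool) : psfun 1 (fun l => nat_of_bool (p (nth 0 l 0))) ->
  exists (M : TM) (c d : nat), forall x, x != [::] ->
  [/\ tm_halts M x, tm_space_bounded M x (c * size x ^ d + c)%N &
      (tm_accepts M x <-> p (code_bits x))].
Proof.
move=> [cm [a Ha]]; have [M HM] := tm_of_cmd cm 1.
(* For nonempty x, n + 2 = size x + 3 is at most 4 size x; the summand 5 absorbs the additive
   constants in W + 3. *)
exists M, (4 ^ a.+1 + 5), a.+1 => x x0.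
pose n := (size x).+1; pose W := ((n + 2) ^ a.+1).+1.
have [|pB ex] := pscmd_mono (leqnSn a) Ha (L := n) (l := [:: code_bits x]) erefl.
  by rewrite /small /= code_bits_lt.
have sx : 0 < size x by case: (x) x0.
have bnd : W.+3 <= (4 ^ a.+1 + 5) * size x ^ a.+1 + (4 ^ a.+1 + 5).
  have : (n + 2) ^ a.+1 <= (4 * size x) ^ a.+1 by rewrite leq_exp2r // /n; lia.
  by rewrite expnMn /W; set y := (4 ^ _); set z := size x ^ _; set w := (n + 2) ^ _; nia.
have init : (fun i => if i == 0 then code_bits x else 0) = regs [:: code_bits x].
  by apply: functional_extensionality => -[|[]].
have [||||H1 H2 H3] := HM x (pbound a.+1 n) W (regs [:: code_bits x; p (code_bits x) : nat]) x0.
- rewrite /W /n; apply: (@leq_trans (((size x).+1 + 2) ^ 1)); first by rewrite expn1; lia.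
  by rewrite ltnW // ltnS leq_pexp2l // addn2.
- by rewrite /pbound ltn_exp2l.
- by rewrite init.
- by rewrite /regs /=; case: (p _).
split=> //; first by move=> k c /H2 /leq_trans; apply.
rewrite H3 /regs /=; by case: (p _).
Qed.

(** * Parsing an encoded instance *)

Lemma enc_ratE x bs : enc_rat x ++ bs = enc_int (numq x) ++ enc_int (denq x) ++ bs.
Proof. by rewrite /enc_rat catA. Qed.

Lemma enc_transE e bs : enc_trans e ++ bs =
  enc_nat (tr_src e) ++ enc_nat (tr_let e) ++ enc_nat (tr_dst e) ++ enc_rat (tr_wt e) ++ bs.
Proof. by rewrite /enc_trans !catA. Qed.

Lemma enc_listE T (f : T -> seq bool) s bs :
  enc_list f s ++ bs = enc_nat (size s) ++ flatten (map f s) ++ bs.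
Proof. by rewrite /enc_list catA. Qed.

Section ParseInstance.
Variables (A : DSA) (t : rat).
Hypothesis wfA : wf_DSA A.
Let N := code_bits (enc_instance A t).

Lemma skip_items (T : Type) (f : T -> seq bool) (sk : nat -> nat) (s : seq T) bs i :
  (forall x bs, sk (code_bits (f x ++ bs)) = code_bits bs) -> i <= size s ->
  iteri i (fun=> sk) (code_bits (flatten (map f s) ++ bs)) =
  code_bits (flatten (map f (drop i s)) ++ bs).
Proof.
move=> skE; elim: i => [|i IH] is_; first by rewrite drop0.
rewrite [LHS]/= IH ?(ltnW is_) //.
case: s is_ {IH} => [//|x0 s] is_.
by rewrite (drop_nth x0 is_) /= -catA skE.
Qed.

Lemma rd_trans_rest_enc e bs : rd_trans_rest (code_bits (enc_trans e ++ bs)) = code_bits bs.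
Proof.
by rewrite /rd_trans_rest enc_transE enc_ratE !rd_rest_enc !rd_int_rest_enc.
Qed.

Lemma at_QF_enc : at_QF N = code_bits (enc_list enc_nat (QF A) ++
  enc_list enc_trans (trans A) ++ enc_rat (disc A) ++ enc_rat t).
Proof. by rewrite /at_QF /N /enc_instance !rd_rest_enc. Qed.

Lemma at_trans_enc : at_trans N = code_bits (enc_list enc_trans (trans A) ++ enc_rat (disc A) ++ enc_rat t).
Proof.
rewrite /at_trans at_QF_enc !enc_listE rd_val_enc rd_rest_enc /skip_nats.
by rewrite (skip_items (sk := rd_rest)) ?drop_size //; apply: rd_rest_enc.
Qed.

Lemma at_disc_enc : at_disc N = code_bits (enc_rat (disc A) ++ enc_rat t).
Proof.
rewrite /at_disc at_trans_enc !enc_listE rd_val_enc rd_rest_enc /skip_trans.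
by rewrite (skip_items (sk := rd_trans_rest)) ?drop_size //; apply: rd_trans_rest_enc.
Qed.

Lemma at_target_enc : at_target N = code_bits (enc_rat t ++ [::]).
Proof. by rewrite /at_target at_disc_enc !enc_ratE !rd_int_rest_enc cats0. Qed.

Lemma rd_qin_enc : rd_val (rd_rest (rd_rest N)) = qin A.
Proof. by rewrite /N /enc_instance !rd_rest_enc rd_val_enc. Qed.

Lemma rd_rat_enc (x : rat) bs : let r := code_bits (enc_rat x ++ bs) in
  let b := rd_int_pos (rd_int_rest r) in
  [/\ b = `|denq x|%N, 0 < b &
      (((rd_int_pos r)%:R - (rd_int_neg r)%:R) / b%:R = x :> rat)%R].
Proof.
move=> r b'; rewrite {}/b' {}/r enc_ratE rd_int_enc rd_int_rest_enc; set b := rd_int_pos _.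
have eb : b = `|denq x|%N.
  rewrite /b; have := denq_gt0 x; case: (denq x) => // d _.
  by rewrite rd_int_pos_enc.
have db : ((denq x)%:~R = b%:R :> rat)%R by rewrite eb pmulrn absz_denq.
by split=> //; [rewrite eb absz_gt0 denq_neq0 | rewrite -db divq_num_den].
Qed.

Lemma final_nodeP v : final_node N v = (v %/ radix N == radix N) && (v %% radix N \in QF A).
Proof.
rewrite /final_node at_QF_enc !enc_listE rd_val_enc rd_rest_enc; congr (_ && _).
have rdE i : i < size (QF A) -> rd_val (skip_nats i (code_bits (flatten [seq enc_nat i | i <- QF A] ++
   enc_nat (size (trans A)) ++ flatten [seq enc_trans i | i <- trans A] ++ enc_rat (disc A) ++ enc_rat t)))
   = nth 0 (QF A) i.
  move=> iQ; rewrite /skip_nats (skip_items (sk := rd_rest)) ?(ltnW iQ) //; last exact: rd_rest_enc.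
  by rewrite (drop_nth 0 iQ) /= -catA rd_val_enc.
apply/hasP/idP => [[i]|vQ].
  by rewrite mem_iota add0n => /andP[_ iQ] /eqP <-; rewrite rdE // mem_nth.
exists (index (v %% radix N) (QF A)); first by rewrite mem_iota add0n index_mem.
by rewrite rdE ?index_mem // nth_index.
Qed.

Definition node_val (D u : nat) : rat := (((u %/ radix N)%:R - (radix N)%:R) / D%:R)%R.

Lemma start_nodeP D u : 0 < D ->
  start_node N D u = (u %% radix N == qin A) && (node_val D u == t).
Proof.
move=> D0; rewrite /start_node rd_qin_enc eq_sym at_target_enc.
have [_] := rd_rat_enc t [::]; rewrite /node_val; lazy zeta; move: (radix N) => K.
move: (rd_int_neg _) (rd_int_pos _) (rd_int_pos (rd_int_rest _)) => k m b b0 et.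
rewrite -{}et; congr (_ && _); rewrite -(eqr_nat rat) !natrD !natrM.
move: (u %/ K) => x.
have Dn : (D%:R != 0 :> rat)%R by rewrite pnatr_eq0 -lt0n.
have bn : (b%:R != 0 :> rat)%R by rewrite pnatr_eq0 -lt0n.
rewrite -[LHS]subr_eq0 -[RHS]subr_eq0.
have -> : ((x%:R - K%:R) / D%:R - (m%:R - k%:R) / b%:R =
  (x%:R * b%:R + k%:R * D%:R - (K%:R * b%:R + m%:R * D%:R)) / (D%:R * b%:R) :> rat)%R.
  by field; rewrite Dn bn.
by rewrite mulf_eq0 invr_eq0 mulf_eq0 (negbTE Dn) (negbTE bn) !orbF.
Qed.

(** The test in [edge_at] is the recurrence for targets multiplied by the denominators D, b and q,
    with the negative terms moved across so that only natural numbers occur. *)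
Lemma edgeP D u v : 0 < D -> reflect
  (exists2 e, e \in trans A & [/\ tr_src e = u %% radix N, tr_dst e = v %% radix N &
     (node_val D u = tr_wt e + disc A * node_val D v)%R]) (edge N D u v).
Proof.
move=> D0.
have Dn : (D%:R != 0 :> rat)%R by rewrite pnatr_eq0 -lt0n.
have eqE e bs : edge_at (code_bits (enc_trans e ++ bs)) N D u v =
   [&& tr_src e == u %% radix N, tr_dst e == v %% radix N &
     (node_val D u == tr_wt e + disc A * node_val D v)%R].
  rewrite /edge_at at_disc_enc enc_transE !rd_rest_enc !rd_val_enc.
  congr [&& _, _ & _].
  have [_ b0 eb] := rd_rat_enc (tr_wt e) bs.
  have [_ q0 eq] := rd_rat_enc (disc A) (enc_rat t).
  (* The discount factor is positive, which is why [edge_at] reads only the positive part of its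
     numerator. *)
  have d0 : rd_int_neg (code_bits (enc_rat (disc A) ++ enc_rat t)) = 0.
    have [_ _ _ _ /andP[l0 _]] := wfA.
    move: l0; rewrite -numq_gt0 /rd_int_neg enc_ratE; case: (numq _) => // n _.
    by have [-> _] := code_bits_cons false (enc_nat n ++ enc_int (denq (disc A)) ++ enc_rat t).
  rewrite d0 subr0 in eq.
  move: eb b0 eq q0; rewrite /node_val; lazy zeta; move: (radix N) => K.
  move: (rd_int_neg _) (rd_int_pos _) (rd_int_pos (rd_int_rest _)) => k m b <- b0.
  move: (rd_int_pos _) (rd_int_pos (rd_int_rest _)) => p q <- q0.
  have qn : (q%:R != 0 :> rat)%R by rewrite pnatr_eq0 -lt0n.
  have bn : (b%:R != 0 :> rat)%R by rewrite pnatr_eq0 -lt0n.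
  rewrite -(eqr_nat rat) !natrD !natrM; move: (u %/ K) (v %/ K) => x y.
  rewrite -[LHS]subr_eq0 -[RHS]subr_eq0.
  have -> : ((x%:R - K%:R) / D%:R - ((m%:R - k%:R) / b%:R + p%:R / q%:R * ((y%:R - K%:R) / D%:R)) =
    (x%:R * q%:R * b%:R + k%:R * q%:R * D%:R + p%:R * K%:R * b%:R -
     (K%:R * q%:R * b%:R + m%:R * q%:R * D%:R + p%:R * y%:R * b%:R)) / (D%:R * b%:R * q%:R) :> rat)%R.
    by field; rewrite Dn bn qn.
  by rewrite mulf_eq0 invr_eq0 !mulf_eq0 (negbTE Dn) (negbTE bn) (negbTE qn) !orbF.
rewrite /edge at_trans_enc !enc_listE rd_val_enc rd_rest_enc.
have atE e0 i : i < size (trans A) ->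
   edge_at (skip_trans i (code_bits (flatten [seq enc_trans i | i <- trans A] ++ enc_rat (disc A) ++ enc_rat t))) N D u v
   = (fun e => [&& tr_src e == u %% radix N, tr_dst e == v %% radix N &
     (node_val D u == tr_wt e + disc A * node_val D v)%R]) (nth e0 (trans A) i).
  move=> iT; rewrite /skip_trans (skip_items (sk := rd_trans_rest)) ?(ltnW iT) //; last exact: rd_trans_rest_enc.
  by rewrite (drop_nth e0 iT) /= -catA eqE.
apply: (iffP hasP) => [[i]|[e eA [e1 e2 e3]]].
  rewrite mem_iota add0n => /andP[_ iT].
  have e0 : nat * nat * nat * rat by case: (trans A) iT => [//|e0].
  rewrite (atE e0) // => /and3P[/eqP h1 /eqP h2 /eqP h3].
  by exists (nth e0 (trans A) i); rewrite ?mem_nth.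
exists (index e (trans A)); first by rewrite mem_iota add0n index_mem.
by rewrite (atE e) ?index_mem // nth_index // e1 e2 -e3 !eqxx.
Qed.

End ParseInstance.

(** * Runs as chains of transitions *)

Lemma gamma_in_delta A q a q' : in_delta A q a q' ->
  exists2 e, e \in trans A &
    [/\ tr_src e = q, tr_let e = a, tr_dst e = q' & gamma A q a q' = tr_wt e].
Proof.
rewrite /in_delta /gamma has_filter.
case E: [seq _ <- _ | _] => [//|e s] _.
have : e \in [seq e <- trans A | [&& tr_src e == q, tr_let e == a & tr_dst e == q']].
  by rewrite E mem_head.
by rewrite mem_filter => /andP[/and3P[/eqP h1 /eqP h2 /eqP h3] eA]; exists e.
Qed.

(** [gamma] takes the first matching entry; as no triple is listed twice, that entry is [e]
    itself. *)
Lemma gamma_trans A e : wf_DSA A -> e \in trans A ->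
  in_delta A (tr_src e) (tr_let e) (tr_dst e) /\
  gamma A (tr_src e) (tr_let e) (tr_dst e) = tr_wt e.
Proof.
move=> [_ _ _ un _] eA.
have ind : in_delta A (tr_src e) (tr_let e) (tr_dst e) by apply/hasP; exists e; rewrite ?eqxx.
split=> //; have [e' e'A [h1 h2 h3 ->]] := gamma_in_delta ind.
suff -> : e' = e by [].
have [n1 n2] : index e' (trans A) < size (trans A) /\ index e (trans A) < size (trans A).
  by rewrite !index_mem.
have := nth_uniq (0, 0, 0) (i := index e' (trans A)) (j := index e (trans A)) _ _ un.
rewrite size_map => /(_ n1 n2); rewrite !(nth_map e) // !nth_index // h1 h2 h3 eqxx.
by move/esym/eqP => ei; rewrite -(nth_index e e'A) ei nth_index.
Qed.

Section Chains.
Variable A : DSA.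
Hypothesis wfA : wf_DSA A.

Fixpoint chain (q : nat) (es : seq (nat * nat * nat * rat)) : bool :=
  if es is e :: es' then [&& e \in trans A, tr_src e == q & chain (tr_dst e) es'] else true.

(** Horner's form of the discounted sum, chosen because its value on a suffix is the remaining
    target there. *)
Definition chain_val (es : seq (nat * nat * nat * rat)) : rat :=
  foldr (fun e acc => tr_wt e + disc A * acc)%R 0%R es.

Definition chain_end (q : nat) (es : seq (nat * nat * nat * rat)) : nat :=
  last q [seq tr_dst e | e <- es].

Lemma run_value_cons q r a w :
  run_value A (a :: w) (q :: r) = (gamma A q a (nth 0%N r 0) + disc A * run_value A w r)%R.
Proof.
rewrite /run_value big_ord_recl /= expr0 mul1r; congr (_ + _)%R.
rewrite mulr_sumr; apply: eq_bigr => i _.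
by rewrite /= /bump /= exprS mulrA.
Qed.

Lemma run_chain w r : size r = (size w).+1 ->
  (forall i, i < size w -> in_delta A (nth 0 r i) (nth 0 w i) (nth 0 r i.+1)) ->
  exists es, [/\ chain (nth 0 r 0) es, chain_end (nth 0 r 0) es = nth 0 r (size w)
    & chain_val es = run_value A w r].
Proof.
elim: w r => [|a w IH] [|q r] // [sr] Hd.
  by exists [::]; split=> //; rewrite /run_value big_ord0.
have [|es [c1 c2 c3]] := IH r sr; first by move=> i iw; apply: (Hd i.+1).
have [e eA [h1 h2 h3 h4]] := gamma_in_delta (Hd 0 isT).
exists (e :: es); split.
- by rewrite /= eA h1 eqxx h3.
- by rewrite /chain_end /= h3.
by rewrite run_value_cons /= -c3; congr (_ + _)%R; rewrite -h4.
Qed.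

Lemma chain_run q es : chain q es -> let w := map tr_let es in let r := q :: map tr_dst es in
  (forall i, i < size w -> in_delta A (nth 0 r i) (nth 0 w i) (nth 0 r i.+1)) /\
  run_value A w r = chain_val es.
Proof.
elim: es q => [|e es IH] q /=; first by split=> //; rewrite /run_value big_ord0.
case/and3P => eA /eqP <- /IH[h1 h2]; have [g1 g2] := gamma_trans wfA eA; split.
  by case=> [|i] ie //=; apply: h1.
by rewrite run_value_cons /= g2 h2.
Qed.

(** Functionality enters from right to left: all accepting runs on the word share the value t, so t
    is their infimum. *)
Lemma exact_valueP t : functional A -> exact_value A t <->
  exists es, [/\ chain (qin A) es, chain_end (qin A) es \in QF A & chain_val es = t].
Proof.
move=> funA; split=> [[w [_ [[r [[[sr r0 rd] rF] rv]] _]]]|[es [ce eF ev]]].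
  have [es [c1 c2 c3]] := run_chain sr rd.
  by rewrite r0 in c1 c2; exists es; rewrite c2 c3.
have [h1 h2] := chain_run ce.
set w := map tr_let es in h1 h2; set r := qin A :: map tr_dst es in h1 h2.
have wo : word_over A w.
  apply/(all_nthP 0) => i iw; have [e eA [_ <- _ _]] := gamma_in_delta (h1 i iw).
  by have [_ _ /allP /(_ e eA) /and3P[_ ? _] _ _] := wfA.
have acc : is_acc_run A w r.
  split; first by split=> //; rewrite /= !size_map.
  suff -> : nth 0 r (size w) = chain_end (qin A) es by [].
  by rewrite /chain_end (last_nth 0) !size_map.
exists w; split=> //; split; first by exists r; rewrite h2.
by move=> r' acc'; rewrite (funA w wo r' r acc' acc) h2 ev.
Qed.

Lemma chain_trans q es : chain q es -> all [in trans A] es.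
Proof. by elim: es q => [//|e es IH] q /= /and3P[-> _ /IH]. Qed.

Lemma chain_end_cons q e es : chain_end q (e :: es) = chain_end (tr_dst e) es.
Proof. by []. Qed.

Section Integrality.
Variable D : nat.
Hypothesis D_wt : {in trans A, forall e, D%:R * tr_wt e \is a Num.int}%R.

(** Each transition costs one factor q, the denominator of the discount factor, because q times the
    discount factor is the integer p. *)
Lemma chain_val_scaled_int es : all [in trans A] es ->
  ((denq (disc A))%:~R ^+ size es * (D%:R * chain_val es) \is a Num.int)%R.
Proof.
elim: es => [|e es IH] /=; first by rewrite mulr0 mulr0 rpred0.
case/andP => eA /IH {}IH.
have -> : ((denq (disc A))%:~R ^+ (size es).+1 * (D%:R * (tr_wt e + disc A * chain_val es)) =
  (denq (disc A))%:~R ^+ (size es).+1 * (D%:R * tr_wt e) +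
  (numq (disc A))%:~R * ((denq (disc A))%:~R ^+ size es * (D%:R * chain_val es)))%R.
  have e1 : ((denq (disc A))%:~R * disc A = (numq (disc A))%:~R :> rat)%R.
    by rewrite -[in X in (_ * X)%R](divq_num_den (disc A)) mulrC divfK // intr_eq0 denq_neq0.
  by rewrite -e1 exprS; ring.
apply: rpredD; apply: rpredM => //; [apply: rpredX; exact: intr_int | exact: D_wt | exact: intr_int].
Qed.

(* Both p X and q^m X are integers and p, q are coprime. *)
Lemma chain_val_tail_int e es : e \in trans A -> all [in trans A] es ->
  (D%:R * chain_val (e :: es) \is a Num.int -> D%:R * chain_val es \is a Num.int)%R.
Proof.
move=> eA esA; have qm := chain_val_scaled_int esA.
set X := (D%:R * chain_val es)%R in qm *; set p := numq (disc A); set q := denq (disc A) in qm.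
move=> /= Hint.
have q0 : (q%:~R != 0 :> rat)%R by rewrite intr_eq0 denq_neq0.
have pX : (p%:~R * X \is a Num.int)%R.
  have -> : (p%:~R * X = q%:~R * (D%:R * (tr_wt e + disc A * chain_val es) - D%:R * tr_wt e))%R.
    have -> : disc A = (p%:~R / q%:~R)%R by rewrite divq_num_den.
    by rewrite /X; field.
  by apply: rpredM; [exact: intr_int | apply: rpredB => //; exact: D_wt].
have cop : coprimez p (q ^+ size es)%R.
  rewrite coprimezXr // /coprimez /p /q.
  by have := coprime_num_den (disc A); rewrite /coprime /gcdz /= => /eqP ->.
have [a [b ab]] := Bezoutz p (q ^+ size es)%R.
have one : (a%:~R * p%:~R + b%:~R * q%:~R ^+ size es = 1 :> rat)%R.
  have : ((a * p + b * q ^+ size es)%:~R = 1 :> rat)%R by rewrite ab; move/eqP: cop => ->.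
  by rewrite intrD !intrM rmorphXn.
have -> : X = (a%:~R * (p%:~R * X) + b%:~R * (q%:~R ^+ size es * X))%R.
  by apply: etrans (esym (mul1r _)) _; apply: etrans (esym (congr1 (fun y => y * X)%R one)) _; ring.
by apply: rpredD; apply: rpredM => //; exact: intr_int.
Qed.

End Integrality.

(** The bound G q is preserved by prepending a transition: G plus the discounted G q is at most G
    q. *)
Lemma chain_val_bound (G : rat) es : (0 <= G)%R ->
  {in trans A, forall e, `|tr_wt e| <= G}%R -> all [in trans A] es ->
  (`|chain_val es| <= G * (denq (disc A))%:~R)%R.
Proof.
have [_ _ _ _ /andP[l0 l1]] := wfA.
move=> G0 Gb; set q := ((denq (disc A))%:~R : rat)%R.
have q0 : (0 < q)%R by rewrite ltr0z denq_gt0.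
have lq : (disc A * q = (numq (disc A))%:~R)%R.
  by rewrite -[in X in (X * _)%R](divq_num_den (disc A)) divfK // gt_eqF.
(* 1 / (1 - p/q) <= q because q - p is a positive integer *)
have l1q : (1 <= q - disc A * q)%R.
  have : (disc A * q < q)%R by rewrite gtr_pMl.
  by rewrite lq /q ltr_int -intrB -[1%R]/(1%:~R)%R ler_int; lia.
elim: es => [|e es IH] /=; first by rewrite normr0 mulr_ge0 // ltW.
case/andP => eA /IH {}IH.
apply: le_trans (ler_normD _ _) _; rewrite normrM (gtr0_norm l0).
have h1 := Gb e eA.
have h2 : (disc A * `|chain_val es| <= disc A * (G * q))%R by rewrite ler_pM2l.
by nra.
Qed.

End Chains.

(** * Bounds by the input number, and correctness of the answer *)

Lemma enc_int_ge z : `|z|%N <= 2 ^ size (enc_int z).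
Proof.
case: z => n /=; rewrite expnS; have := enc_nat_lt n; lia.
Qed.

Lemma denq_enc_le x : `|denq x|%N <= 2 ^ size (enc_rat x).
Proof.
apply: leq_trans (enc_int_ge _) _; rewrite leq_pexp2l // size_cat; exact: leq_addl.
Qed.

Lemma numq_enc_le x : `|numq x|%N <= 2 ^ size (enc_rat x).
Proof.
apply: leq_trans (enc_int_ge _) _; rewrite leq_pexp2l // size_cat; exact: leq_addr.
Qed.

Lemma size_enc_trans e : size (enc_rat (tr_wt e)) <= size (enc_trans e).
Proof. by rewrite /enc_trans !size_cat; lia. Qed.

Section Instance.
Variables (A : DSA) (t : rat).
Hypothesis wfA : wf_DSA A.
Let N := code_bits (enc_instance A t).
Let K := radix N.

Lemma le_code m k : m <= 2 ^ k -> k <= size (enc_instance A t) -> m <= N.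
Proof.
move=> mk ks; apply: leq_trans mk _; apply: leq_trans (code_bits_ge _).
by rewrite leq_pexp2l.
Qed.

(** A product rather than a least common multiple: its size is bounded factor by factor, as lengths
    of encodings add up. *)
Definition common_den : nat := `|denq t|%N * \prod_(e <- trans A) `|denq (tr_wt e)|%N.
Let D := common_den.

Lemma common_den_gt0 : 0 < D.
Proof.
rewrite /D /common_den muln_gt0 absz_gt0 denq_neq0 /=.
by rewrite prodn_cond_gt0 // => e _; rewrite absz_gt0 denq_neq0.
Qed.

Lemma common_den_le : D <= N.
Proof.
apply: (@le_code _ (size (enc_rat t) + size (flatten (map enc_trans (trans A))))); last first.
  by rewrite /enc_instance /enc_list !size_cat; lia.
rewrite expnD leq_mul ?denq_enc_le //.
elim: (trans A) => [|e s IH]; first by rewrite big_nil.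
rewrite big_cons /= size_cat expnD leq_mul //.
by apply: leq_trans (denq_enc_le _) _; rewrite leq_pexp2l // size_enc_trans.
Qed.

Lemma wt_le_code : {in trans A, forall e, `|tr_wt e| <= N%:R}%R.
Proof.
move=> e eA; have nN : `|numq (tr_wt e)|%N <= N.
  apply: le_code (numq_enc_le _) _; apply: leq_trans (size_enc_trans e) _.
  apply: (@leq_trans (size (flatten (map enc_trans (trans A))))); last first.
    by rewrite /enc_instance /enc_list !size_cat; lia.
  elim: (trans A) eA => [//|e' s IH]; rewrite inE /= size_cat => /orP[/eqP->|/IH].
    exact: leq_addr.
  by move/leq_trans; apply; apply: leq_addl.
rewrite -[X in (`|X|)%R](divq_num_den (tr_wt e)) normrM.
have d1 : (1 <= (denq (tr_wt e))%:~R :> rat)%R by rewrite ler1z; have := denq_gt0 (tr_wt e); lia.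
apply: (@le_trans _ _ `|(numq (tr_wt e))%:~R : rat|%R).
  have d0 := lt_le_trans ltr01 d1.
  by rewrite ler_piMr // ger0_norm ?invr_ge0 ?(ltW d0) // invf_le1.
by rewrite -intr_norm -abszE -pmulrn ler_nat.
Qed.

Lemma disc_den_le : ((denq (disc A))%:~R <= N%:R :> rat)%R.
Proof.
rewrite -absz_denq -pmulrn ler_nat; apply: le_code (denq_enc_le _) _.
by rewrite /enc_instance !size_cat; lia.
Qed.

Lemma nQ_le : nQ A <= N.
Proof.
apply: le_code (ltnW (enc_nat_lt _)) _.
by rewrite /enc_instance !size_cat; lia.
Qed.

Lemma mul_den_int x : `|denq x|%N %| D -> (D%:R * x \is a Num.int)%R.
Proof.
case/dvdnP => d ->.
have -> : ((d * `|denq x|%N)%:R * x = d%:R * (numq x)%:~R)%R.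
  rewrite natrM -mulrA; congr (_ * _)%R.
  by rewrite pmulrn absz_denq -[X in (_ * X)%R](divq_num_den x) mulrC divfK // intr_eq0 denq_neq0.
by apply: rpredM; [apply: rpred_nat | apply: intr_int].
Qed.

Lemma common_den_wt : {in trans A, forall e, D%:R * tr_wt e \is a Num.int}%R.
Proof.
move=> e eA; apply: mul_den_int; rewrite /D /common_den.
by rewrite dvdn_mull // (big_rem e) //= dvdn_mulr.
Qed.

Lemma common_den_target : (D%:R * t \is a Num.int)%R.
Proof. by apply: mul_den_int; rewrite /D /common_den dvdn_mulr. Qed.

(** For an integral scaled value [numq] is the value itself, and after the shift by [K] the absolute
    value loses nothing. *)
Definition chain_node (q : nat) (es : seq (nat * nat * nat * rat)) : nat :=
  q + K * absz (numq (D%:R * chain_val A es) + K%:Z)%R.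

Lemma chain_nodeP q es : q < nQ A -> all [in trans A] es -> (D%:R * chain_val A es \is a Num.int)%R ->
  [/\ chain_node q es %% K = q, node_val A t D (chain_node q es) = chain_val A es &
      chain_node q es < nodes N].
Proof.
move=> qQ esA vint; have qK : q < K by rewrite /K /radix; have := nQ_le; nia.
set z := numq (D%:R * chain_val A es)%R.
have zE : (z%:~R = D%:R * chain_val A es)%R by rewrite /z numqK.
have zb : (`|z%:~R : rat| <= (N * N * N)%:R)%R.
  rewrite zE normrM (natrM _ (N * N)) (natrM _ N N) -mulrA ger0_norm ?ler0n //.
  apply: ler_pM; rewrite ?ler0n ?ler_nat ?common_den_le //.
  apply: le_trans (chain_val_bound wfA _ wt_le_code esA) _; first exact: ler0n.
  by rewrite ler_wpM2l ?ler0n // disc_den_le.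
have {}zb : `|z|%N <= N * N * N by rewrite -(ler_nat rat) natr_absz intr_norm.
have Kz : Posz (absz (z + K%:Z)%R) = (z + K%:Z)%R by rewrite /K /radix; lia.
rewrite /chain_node -/z; set x := absz _ in Kz *.
have K0 : 0 < K by [].
have dv : (q + K * x) %/ K = x by rewrite mulnC addnC divnMDl // divn_small // addn0.
split.
- by rewrite mulnC addnC modnMDl modn_small.
- rewrite /node_val -/N -/K dv.
  have -> : (x%:R = z%:~R + K%:R :> rat)%R by rewrite pmulrn Kz intrD.
  by rewrite addrK zE mulrC mulKf // pnatr_eq0 -lt0n common_den_gt0.
rewrite /nodes -/K; have : x < K * 2 by rewrite /K /radix in Kz *; lia.
by nia.
Qed.

Lemma trans_bounds e : e \in trans A -> tr_src e < nQ A /\ tr_dst e < nQ A.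
Proof. by have [_ _ /allP H _ _] := wfA => /H /and3P[]. Qed.

(** Integrality is passed from the front to the tail by [chain_val_tail_int]. It cannot be obtained
    from the back: prepending a transition to an integral suffix may introduce the denominator q. *)
Lemma chain_path q es : q < nQ A -> chain A q es -> (D%:R * chain_val A es \is a Num.int)%R ->
  exists p, [/\ path (edge N D) (chain_node q es) p, all (fun u => u < nodes N) p &
     last (chain_node q es) p = chain_node (chain_end q es) [::]].
Proof.
elim: es q => [|e es IH] q qQ; first by exists [::].
move=> che vint; have := che => /= /and3P[eA /eqP sq ch].
have esA := chain_trans ch; have [_ dQ] := trans_bounds eA.
have vint' := chain_val_tail_int common_den_wt eA esA vint.
have [p [pp pV pl]] := IH _ dQ ch vint'.
have [m1 v1 _] := chain_nodeP qQ (chain_trans che) vint.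
have [m2 v2 l2] := chain_nodeP dQ esA vint'.
exists (chain_node (tr_dst e) es :: p); split; rewrite /= ?l2 //.
rewrite pp andbT; apply/(edgeP _ wfA) => //; first exact: common_den_gt0.
by exists e => //; rewrite -/N -/K m1 m2 v1 v2 sq.
Qed.

(** Soundness for every positive [D']: edges state exact rational identities, and the final value 0
    is that of the empty suffix. *)
Lemma path_chain D' u p : 0 < D' -> path (edge N D') u p -> node_val A t D' (last u p) = 0%R ->
  exists es, [/\ chain A (u %% K) es, chain_end (u %% K) es = last u p %% K &
    chain_val A es = node_val A t D' u].
Proof.
move=> D0; elim: p u => [|v p IH] u /=; first by exists [::].
case/andP => /(edgeP _ wfA _ _ D0)[e eA [h1 h2 h3]] pp pl.
have [es [c1 c2 c3]] := IH v pp pl.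
exists (e :: es); split.
- by rewrite /= eA h1 eqxx h2.
- by rewrite chain_end_cons h2.
by rewrite /= c3 h3.
Qed.

Lemma answerP : functional A -> answer N <-> exact_value A t.
Proof.
move=> funA; rewrite exact_valueP //; split.
  case/hasP => D' _ /andP[D0 /hasP[u]]; rewrite mem_iota add0n => /andP[_ uV].
  case/andP => us /hasP[v]; rewrite mem_iota add0n => /andP[_ vV] /andP[vf].
  rewrite /reach !modn_small // => /reach_in_path[p pp pl].
  move: us vf; rewrite start_nodeP // final_nodeP.
  move=> /andP[/eqP uq /eqP ut] /andP[/eqP vK vF].
  have [|es [c1 c2 c3]] := path_chain D0 pp.
    by rewrite pl /node_val vK subrr mul0r.
  by exists es; rewrite -uq c1 c2 pl vF c3 ut.
case=> es [ce eF ev].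
have [qQ QFQ _ _ _] := wfA.
have vint : (D%:R * chain_val A es \is a Num.int)%R by rewrite ev common_den_target.
have [p [pp pV pl]] := chain_path qQ ce vint.
have [m1 v1 l1] := chain_nodeP qQ (chain_trans ce) vint.
have int0 : (D%:R * chain_val A [::] \is a Num.int)%R by rewrite mulr0 rpred0.
have [m2 v2 l2] := @chain_nodeP (chain_end (qin A) es) [::] (allP QFQ _ eF) isT int0.
apply/hasP; exists D; first by rewrite mem_iota /= add0n ltnS /radix; have := common_den_le; nia.
rewrite common_den_gt0; apply/hasP; exists (chain_node (qin A) es).
  by rewrite mem_iota.
rewrite start_nodeP ?common_den_gt0 // m1 v1 ev !eqxx.
apply/hasP; exists (chain_node (chain_end (qin A) es) [::]); first by rewrite mem_iota.
rewrite final_nodeP m2 eF andbT; apply/andP; split.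
  (* The empty suffix has value 0, so its shifted target is exactly the radix, as [final_node]
     demands. *)
  move/eqP: v2; rewrite /node_val mulf_eq0 invr_eq0 pnatr_eq0.
  by rewrite [_ == 0]gtn_eqF ?common_den_gt0 // orbF subr_eq0 eqr_nat.
rewrite /reach !modn_small // -pl; apply: path_reach_in => //.
exact: up_logP.
Qed.

End Instance.

(** * From functional to unambiguous and deterministic automata *)

Lemma unambiguous_functional A : unambiguous A -> functional A.
Proof. by move=> unA w wA r1 r2 a1 a2; rewrite (unA w wA r1 r2 a1 a2). Qed.

Lemma deterministic_unambiguous A : deterministic A -> unambiguous A.
Proof.
move=> detA w _ r1 r2 [[s1 i1 d1] _] [[s2 i2 d2] _].
apply: (@eq_from_nth _ 0); first by rewrite s1 s2.
move=> i; rewrite s1 ltnS; elim: i => [|i IH] iw; first by rewrite i1 i2.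
by apply: detA (d1 i iw) _; rewrite IH 1?ltnW //; apply: d2.
Qed.

Lemma exact_value_in_PSPACE_sub (P Q : DSA -> Prop) : (forall A, Q A -> P A) ->
  exact_value_in_PSPACE P -> exact_value_in_PSPACE Q.
Proof.
move=> QP [M [c [d H]]]; exists M, c, d => A t wfA /QP; exact: H.
Qed.

Lemma functional_in_PSPACE : exact_value_in_PSPACE functional.
Proof.
have [M [c [d H]]] := psfun_decider psfun_answer.
exists M, c, d => A t wfA funA x.
have [|h1 h2 h3] := H x; first by rewrite /x /enc_instance /enc_nat; case: (flatten _).
by split=> //; rewrite h3; apply: answerP.
Qed.

Theorem theorem26 :
  exact_value_in_PSPACE functional /\
  exact_value_in_PSPACE unambiguous /\
  exact_value_in_PSPACE deterministic.
Proof.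
split; first exact: functional_in_PSPACE.
split; apply: exact_value_in_PSPACE_sub functional_in_PSPACE => A.
  exact: unambiguous_functional.
by move/deterministic_unambiguous/unambiguous_functional.
Qed.
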